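(* (Pieri rules for Young noncommutative Schur functions.) Let $\alpha$ be a composition and $n\ge1$. Then in $\mathsf{NSym}$ $$\mathscr{S}^*_\alpha\mathscr{S}^*_{(n)}=\sum_\beta oc_{\tilde\alpha(n)}^{\tilde\beta}\,\mathscr{S}^*_\beta,$$ where $\beta$ runs over all compositions for which there is a saturated chain $\alpha=\alpha^0\lessdot\alpha^1\lessdot\cdots\lessdot\alpha^n=\beta$ in $\mathcal L$ whose column sequence is strictly increasing. Also, $$\mathscr{S}^*_\alpha\mathscr{S}^*_{(1^n)}=\sum_\beta oc_{\tilde\alpha(1^n)}^{\tilde\beta}\,\mathscr{S}^*_\beta,$$ where $\beta$ runs over all compositions for which there is a saturated chain $\alpha=\alpha^0\lessdot\alpha^1\lessdot\cdots\lessdot\alpha^n=\beta$ in $\mathcal L$ whose column sequence is weakly decreasing.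
   Context: **$\mathsf{OQSym}$ and $\mathsf{NSym}$.** Let $k$ be a commutative ring with unity and $A_{-1}=k\langle\langle x_1,x_2,\dots\rangle\rangle/(x_ix_j+x_jx_i,\ i>j)$. For a composition $\alpha$, $M_\alpha=\sum_{i_1<\cdots<i_r}x_{i_1}^{\alpha_1}\cdots x_{i_r}^{\alpha_r}$; $F_\alpha=\sum_\beta M_\beta$ over all refinements $\beta$ of $\alpha$. $\mathsf{OQSym}$ is the subalgebra of $A_{-1}$ with basis $\{M_\alpha\}$. $\mathsf{NSym}$ is the free associative $k$-algebra on $H_1,H_2,\dots$, $H_\alpha=H_{\alpha_1}\cdots H_{\alpha_r}$, paired with $\mathsf{OQSym}$ by $\langle M_\alpha,H_\beta\rangle=\delta_{\alpha,\beta}$. **Composition poset.** $\mathcal L$ is the poset on compositions in which $(\alpha_1,\dots,\alpha_r)$ is covered by $(\alpha_1,\dots,\alpha_r,1)$ and by $(\alpha_1,\dots,\alpha_k+1,\dots,\alpha_r)$ whenever $\alpha_i\ne\alpha_k$ for all $i>k$. The diagram of $\alpha$ has $\alpha_i$ left-justified boxes in row $i$ (rows from the top). The column sequence of a saturated chain $\alpha^0\lessdot\cdots\lessdot\alpha^n$ (each step a cover) is $c_1,\dots,c_n$, where $c_i$ is the column of the box added in passing from $\alpha^{i-1}$ to $\alpha^i$. **Odd quasisymmetric Schur functions.** A standard Young composition tableau (SYCT) of shape $\alpha\vDash n$ is a bijective filling $\tau$ of the diagram of $\alpha$ with $1,\dots,n$ such that rows increase left to right, the first column increases top to bottom, and if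 $i>j$, $(j,k+1),(i,k)\in\alpha$ and $\tau(i,k)\le\tau(j,k+1)$, then $(i,k+1)\in\alpha$ and $\tau(i,k+1)<\tau(j,k+1)$. $c(\tau)$ is the composition of $n$ whose set of proper partial sums is $\{m\in[n-1]:m+1\text{ weakly left of }m\text{ in }\tau\}$. $\mathrm{inv}^c(\tau)$ is the number of pairs of boxes with $j<j'$ and $\tau(i,j)>\tau(i',j')$. $\tilde\alpha$ is the partition obtained by sorting the parts of $\alpha$; $NE(\lambda)$ is the number of pairs of boxes of $\lambda$ with $i>i'$, $j<j'$. $\mathscr{S}_\alpha=(-1)^{NE(\tilde\alpha)}\sum_{\tau\in\mathrm{SYCT}(\alpha)}(-1)^{\mathrm{inv}^c(\tau)}F_{c(\tau)}$; these form a basis of $\mathsf{OQSym}$ and $\{\mathscr{S}^*_\alpha\}\subset\mathsf{NSym}$ is the dual basis, $\langle\mathscr{S}_\alpha,\mathscr{S}^*_\beta\rangle=\delta_{\alpha,\beta}$. **Coefficients.** $T_\lambda$ is the standard tableau of shape $\lambda$ filled row by row; $\mathrm{inv}(T)$ is the number of pairs of boxes with $i<i'$, $T(i,j)\ge T(i',j')$; $(T_\lambda)_S$, for a standard skew tableau $S$ of shape $\mu/\lambda$, is obtained by adding $|\lambda|$ to the entries of $S$ and filling $\lambda$ with $T_\lambda$. In general $oc_{\lambda\mu}^\nu=\sum_S(-1)^{\mathrm{inv}((T_\lambda)_S)}$ over standard $S$ of shape $\nu/\lambda$ with rectification $T_\mu$. In particular for $\mu/\lambda$ a horizontal strip of size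 $n$ (no two boxes in a column), $oc_{\lambda(n)}^\mu=(-1)^{\mathrm{inv}((T_\lambda)_S)}$ with $S$ labelled $1,\dots,n$ left to right; for $\mu/\lambda$ a vertical strip of size $n$ (no two boxes in a row), $oc_{\lambda(1^n)}^\mu=(-1)^{\mathrm{inv}((T_\lambda)_S)}$ with $S$ labelled $1,\dots,n$ top to bottom. *)

(* Defs.v *)
From HB Require Import structures.
From mathcomp Require Import all_boot all_order all_algebra.
From mathcomp Require Import finmap monalg.
From mathcomp Require Import boolp.

Set Implicit Arguments.
Unset Strict Implicit.
Unset Printing Implicit Defensive.

Import GRing.Theory.

(* ---------------------------------------------------------------------- *)
(* Compositions                                                           *)

Definition is_comp (a : seq nat) : bool := all (leq 1) a.

(* All compositions of n, each listed once (see mem_comps, comps_uniq).     *)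
Fixpoint comps (n : nat) : seq (seq nat) :=
  if n is m.+1 then
    [seq 1 :: b | b <- comps m]
    ++ [seq (head 0 b).+1 :: behead b | b <- comps m & b != [::]]
  else [:: [::]].

Lemma mem_comps n b : (b \in comps n) = is_comp b && (sumn b == n).
Proof.
elim: n b => [|n IHn] b /=.
  by rewrite inE; case: b => [|[|a] b] //=; rewrite addSn andbF.
rewrite mem_cat; apply/orP/andP => [[]|[]].
- case/mapP=> c; rewrite IHn => /andP[c_comp /eqP <-] ->.
  by split=> //=; rewrite add1n.
- case/mapP=> c; rewrite mem_filter IHn => /and3P[c_neq0 c_comp /eqP <-] ->.
  case: c c_neq0 c_comp => [|a c] //= _ /andP[_ c_comp].
  by split; rewrite ?addSn.
case: b => [|[|[|a]] b] //= b_comp b_sum; [left|right].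
- by apply/mapP; exists b; rewrite // IHn b_comp.
- apply/mapP; exists (a.+1 :: b) => //.
  by rewrite mem_filter IHn /= b_comp.
Qed.

Lemma comps_uniq n : uniq (comps n).
Proof.
elim: n => [|n IHn] //=; rewrite cat_uniq map_inj_uniq => [|b c [] //].
rewrite IHn /= map_inj_in_uniq ?filter_uniq // ?andbT.
- apply/hasPn=> d /mapP[c]; rewrite mem_filter mem_comps => /and3P[].
  by case: c => [|[|a] c] //= _ _ _ ->; apply/mapP=> -[].
- move=> b c; rewrite !mem_filter => /andP[+ _] /andP[+ _].
  by case: b => [|x b] //; case: c => [|y c] //= _ _ [-> ->].
Qed.

Definition partial_sums (a : seq nat) : seq nat := scanl addn 0 a.

(* The composition of n with set of proper partial sums {m in [n-1] | D m}. *)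
Definition comp_of_psums (n : nat) (D : pred nat) : seq nat :=
  pairmap (fun x y => y - x) 0 [seq m <- iota 1 n | (m == n) || D m].

Definition refines (b a : seq nat) : bool :=
  (sumn b == sumn a) && all [in partial_sums b] (partial_sums a).

(* The partition obtained by sorting the parts of a.                        *)
Definition sort_comp (a : seq nat) : seq nat := sort geq a.

(* ---------------------------------------------------------------------- *)
(* Diagrams and tableaux                                                  *)

(* A box is (row, column); both are numbered from 0.                        *)
Definition box : Type := nat * nat.

(* In row reading order.                                                    *)
Definition boxes (a : seq nat) : seq box :=
  [seq (i, j) | i <- iota 0 (size a), j <- iota 0 (nth 0 a i)].

Definition npairs (P : rel box) (t : seq box) : nat :=
  count (fun p => P p.1 p.2) [seq (b, c) | b <- t, c <- t].

Definition NE (l : seq nat) : nat :=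
  npairs (fun b c => (c.1 < b.1) && (b.2 < c.2)) (boxes l).

(* A bijective filling of a finite set of boxes with 1, ..., n is encoded by
   the list t of its boxes in the order of their entries, so that the fillings
   of a diagram D (given as a list) are the members of [permutations D].  In
   this encoding the row-by-row tableau T_l is [boxes l], and (T_l)_S is
   [boxes l ++ S].                                                          *)
Definition entry (t : seq box) (b : box) : nat := (index b t).+1.
Definition box_of (t : seq box) (m : nat) : box := nth (0, 0) t m.-1.

Definition rows_increase (t : seq box) : bool :=
  all2rel (fun b c => (b.1 == c.1) && (b.2 < c.2) ==>
                      (entry t b < entry t c)) t.

Definition columns_increase (t : seq box) : bool :=
  all2rel (fun b c => (b.2 == c.2) && (b.1 < c.1) ==>
                      (entry t b < entry t c)) t.

Definition first_column_increases (t : seq box) : bool :=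
  all2rel (fun b c => [&& b.2 == 0, c.2 == 0 & b.1 < c.1] ==>
                      (entry t b < entry t c)) t.

(* Here b = (i, k) and c = (j, k+1).                                        *)
Definition triple_rule (t : seq box) : bool :=
  all2rel (fun b c =>
    [&& c.1 < b.1, c.2 == b.2.+1 & entry t b <= entry t c] ==>
    ((b.1, b.2.+1) \in t) && (entry t (b.1, b.2.+1) < entry t c)) t.

Definition SYCT (a : seq nat) : seq (seq box) :=
  [seq t <- permutations (boxes a)
     | [&& rows_increase t, first_column_increases t & triple_rule t]].

Definition descent_comp (t : seq box) : seq nat :=
  comp_of_psums (size t) (fun m => (box_of t m.+1).2 <= (box_of t m).2).

Definition tab_invc (t : seq box) : nat :=
  npairs (fun b c => (b.2 < c.2) && (entry t c < entry t b)) t.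

Definition tab_inv (t : seq box) : nat :=
  npairs (fun b c => (b.1 < c.1) && (entry t c <= entry t b)) t.

(* Standard skew tableaux of shape n/l (none unless l is contained in n).   *)
Definition skew_SYT (n l : seq nat) : seq (seq box) :=
  if all [in boxes n] (boxes l) then
    [seq S <- permutations [seq b <- boxes n | b \notin boxes l]
       | rows_increase S && columns_increase S]
  else [::].

(* The jeu de taquin slide into the empty box h.  As the boxes are scanned in
   the order of their entries, the first one found to the right of or below
   the current hole is the one with the smaller entry.                      *)
Fixpoint jdt_slide (h : box) (t : seq box) : seq box :=
  if t is b :: t' then
    if (b == (h.1, h.2.+1)) || (b == (h.1.+1, h.2))
    then h :: jdt_slide b t' else b :: jdt_slide h t'
  else [::].

(* Slides are performed into the boxes of l, in the reverse of the row reading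
   order: each time, the last box of the last row is an inner corner.       *)
Definition rectification (l : seq nat) (S : seq box) : seq box :=
  foldr jdt_slide S (boxes l).

Definition oc (l m n : seq nat) : int :=
  (\sum_(S <- skew_SYT n l | rectification l S == boxes m)
     (-1) ^+ tab_inv (boxes l ++ S))%R.

(* ---------------------------------------------------------------------- *)
(* The composition poset                                                  *)

Definition covers (a b : seq nat) : bool :=
  (b == rcons a 1) ||
  has (fun k => (nth 0 a k \notin drop k.+1 a) &&
                (b == set_nth 0 a k (nth 0 a k).+1)) (iota 0 (size a)).

Definition added_column (a b : seq nat) : nat :=
  (head (0, 0) [seq x <- boxes b | x \notin boxes a]).2.

(* [s] lists a^1, ..., a^n in a saturated chain a = a^0, a^1, ..., a^n = b
   whose column sequence is sorted for r.                                   *)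
Definition saturated_chain (r : rel nat) (a : seq nat) (n : nat) (b : seq nat)
    : Prop :=
  exists s : seq (seq nat),
    [/\ size s = n, path covers a s, last a s = b
      & sorted r (pairmap added_column a s)].

(* ---------------------------------------------------------------------- *)
(* OQSym and NSym                                                         *)

Local Open Scope ring_scope.

(* The number of transpositions x_j x_i = - x_i x_j (j > i) that sort w.    *)
Fixpoint word_inv (w : seq nat) : nat :=
  if w is x :: w' then (count (gtn x) w' + word_inv w')%N else 0%N.

(* The word x_(i_1)^(a_1) ... x_(i_r)^(a_r).                                *)
Definition power_word (i a : seq nat) : seq nat :=
  flatten [seq nseq p.2 p.1 | p <- zip i a].

Section Algebras.
Variable k : comNzRingType.

(* Noncommutative power series over k, as the function giving the coefficient
   of each word; the letter i stands for the variable x_(i+1).  Elements of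
   A_{-1} are represented by such series.                                   *)
Definition ncseries : Type := seq nat -> k.

(* The coefficient in A_{-1} of the monomial given by the sorted word w.  It
   depends only on the class of f modulo the relations: see
   anticomm_coef.                                                           *)
Definition Acoef (f : ncseries) (w : seq nat) : k :=
  \sum_(u <- permutations w) (-1) ^+ word_inv u * f u.

(* For a composition a, the indices i are determined by w.                  *)
Definition M_ (a : seq nat) : ncseries := fun w =>
  `[< exists i : seq nat,
        [/\ size i = size a, sorted ltn i & w = power_word i a] >]%:R.

Definition F_ (a : seq nat) : ncseries := fun w =>
  \sum_(b <- comps (sumn a) | refines b a) M_ b w.

Definition S_ (a : seq nat) : ncseries := fun w =>
  (-1) ^+ NE (sort_comp a) *
    \sum_(t <- SYCT a) (-1) ^+ tab_invc t * F_ (descent_comp t) w.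

(* The free algebra, as the monoid algebra of a free monoid; the letter i
   stands for H_(i+1), so that words correspond to compositions.            *)
Definition NSym : Type := {malg k[{fmonom nat}]}.
HB.instance Definition _ := GRing.Lalgebra.on NSym.

Definition H_ (a : seq nat) : NSym := \prod_(p <- a) << fmu p.-1 >>.

Definition word_comp (w : {fmonom nat}) : seq nat := [seq i.+1 | i <- w].

(* The pairing between OQSym and NSym: the coefficient of M_a in an element of
   OQSym is its coefficient at x_1^(a_1) ... x_r^(a_r).  See pairingMH.     *)
Definition pairing (f : ncseries) (h : NSym) : k :=
  \sum_(w <- msupp h)
    Acoef f (power_word (iota 0 (size w)) (word_comp w)) * h@_w.

Lemma word_inv_swap u v i j : (i < j)%N ->
  word_inv (u ++ j :: i :: v) = (word_inv (u ++ i :: j :: v)).+1.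
Proof.
move=> lt_ij; elim: u => [|x u IHu] /=.
  by rewrite lt_ij ltnNge (ltnW lt_ij) /= add0n add1n addSn addnCA.
by rewrite IHu addnS !count_cat /= [((j < x) + _)%N]addnCA.
Qed.

Lemma anticomm_coef u v w i j : i != j ->
  Acoef (fun z => (z == u ++ j :: i :: v)%:R + (z == u ++ i :: j :: v)%:R) w
    = 0.
Proof.
move=> ne_ij; wlog lt_ij : i j ne_ij / (i < j)%N => [wlg|].
  move: (ne_ij); rewrite neq_ltn => /orP[lt_ij|lt_ji]; first exact: wlg.
  rewrite -[RHS](wlg j i) 1?eq_sym //.
  by apply: eq_bigr => z _; rewrite addrC.
have Acoef1 t : \sum_(z <- permutations w) (-1) ^+ word_inv z * (z == t)%:R
    = (-1) ^+ word_inv t * (perm_eq t w)%:R :> k.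
  rewrite -mem_permutations; case: (boolP (t \in _)) => t_w.
    rewrite (big_rem t) //= eqxx big_seq big1 ?addr0 // => z.
    rewrite mem_rem_uniq ?permutations_uniq // => /andP[/negbTE /= -> _].
    by rewrite mulr0.
  rewrite mulr0 big_seq big1 // => z z_w.
  by case: eqP t_w => [<-|_ _]; rewrite ?z_w ?mulr0.
rewrite /Acoef; under eq_bigr do rewrite mulrDr.
rewrite big_split /= !Acoef1 word_inv_swap // exprS mulN1r mulNr.
rewrite (_ : perm_eq _ w = perm_eq (u ++ i :: j :: v) w) ?addNr //.
apply: permPl; rewrite perm_cat2l.
by rewrite (perm_catCA [:: j] [:: i] v).
Qed.

Lemma pairing_linear f c (g h : NSym) :
  pairing f (c *: g + h) = c * pairing f g + pairing f h.
Proof.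
pose P (w : {fmonom nat}) := Acoef f (power_word (iota 0 (size w)) (word_comp w)).
have pairingE (d : {fset {fmonom nat}}) (x : NSym) :
    {subset msupp x <= d} -> pairing f x = \sum_(w <- d) P w * x@_w.
  move=> sub; rewrite /pairing; apply: big_fset_incl => [|w _].
    exact/fsubsetP.
  by move/mcoeff_outdom=> ->; rewrite mulr0.
pose d := (msupp (c *: g + h) `|` msupp g `|` msupp h)%fset.
rewrite !(@pairingE d); try by move=> w w_d; rewrite !inE w_d ?orbT.
rewrite mulr_sumr -big_split /=; apply: eq_bigr => w _.
by rewrite mcoeffD mcoeffZ mulrDr mulrCA.
Qed.

Lemma H_E a : H_ a = << FMonom [seq p.-1 | p <- a] >>.
Proof.
elim: a => [|p a IHa]; rewrite /H_ ?big_nil ?big_cons /=.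
  by congr << _ >>; apply/val_inj/fm1.
rewrite -/(H_ a) IHa [LHS]malgM_def fgmulUU mulr1; congr << _ >>.
by apply/val_inj; rewrite /= fmM fmU.
Qed.

Lemma power_word_leq m i a : all (leq m) i -> all (leq m) (power_word i a).
Proof.
rewrite /power_word; elim: i a => [|x i IHi] [|p a] //= /andP[m_x m_i].
by rewrite all_cat IHi // andbT all_nseq m_x orbT.
Qed.

Lemma power_word_sorted i a : sorted ltn i -> sorted leq (power_word i a).
Proof.
elim: i a => [|x i IHi] [|p a] // x_i.
rewrite /power_word /= -/(power_word i a).
have x_lt : all (leq x) i.
  by apply: sub_all (order_path_min ltn_trans x_i) => y /ltnW.
elim: p => [|p IHp] /=; first exact/IHi/path_sorted/x_i.
rewrite path_min_sorted // all_cat power_word_leq // andbT.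
by rewrite all_nseq leqnn orbT.
Qed.

Lemma power_word_inj i j a b : is_comp a -> is_comp b ->
    size i = size a -> size j = size b -> sorted ltn i -> sorted ltn j ->
  power_word i a = power_word j b -> a = b.
Proof.
have run x i' a' p : sorted ltn (x :: i') ->
    count_mem x (nseq p x ++ power_word i' a') = p /\
    [seq y <- nseq p x ++ power_word i' a' | x != y] = power_word i' a'.
  move=> x_i; have x_lt : all (leq x.+1) (power_word i' a').
    exact/power_word_leq/(order_path_min ltn_trans x_i).
  rewrite count_cat filter_cat count_nseq /= eqxx mul1n.
  have ->: [seq y <- nseq p x | x != y] = [::].
    by elim: p => //= p ->; rewrite eqxx.
  split; last first.
    by apply/all_filterP; apply: sub_all x_lt => y /=; case: ltngtP.
  rewrite (_ : count _ _ = 0%N) ?addn0 //; apply/eqP.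
  rewrite -leqn0 leqNgt -has_count; apply/hasPn => y /(allP x_lt) /=.
  by case: ltngtP.
elim: a i j b => [|p a IHa] [|x i] [|y j] [|q b] //=.
- by rewrite /power_word /=; case: q.
- by rewrite /power_word /=; case: p.
move=> /andP[p_gt0 a_c] /andP[q_gt0 b_c] [si] [sj] x_i y_j.
rewrite /power_word /= -!/(power_word _ _) => eq_w.
have eq_xy : x = y by case: p q p_gt0 q_gt0 eq_w => [|p] [|q] //= _ _ [].
subst y; have [cp fp] := run x i a p x_i; have [cq fq] := run x j b q y_j.
have <- : p = q by rewrite -cp eq_w cq.
congr cons; apply: (IHa i j) => //; first exact: path_sorted x_i.
  exact: path_sorted y_j.
by rewrite -fp eq_w fq.
Qed.

Lemma pairingMH a b : is_comp a -> is_comp b ->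
  pairing (M_ a) (H_ b) = (a == b)%:R.
Proof.
move=> a_comp b_comp; rewrite H_E /pairing msuppU oner_eq0 big_seq_fset1.
rewrite mcoeffUU mulr1 /word_comp /= size_map -map_comp.
have -> : [seq (succn \o predn) p | p <- b] = b.
  by elim: b b_comp => //= p b IHb /andP[/prednK -> /IHb ->].
have srt : sorted ltn (iota 0 (size b)) by exact: iota_ltn_sorted.
set w := power_word _ b.
have wP : sorted leq w by exact: power_word_sorted.
have inv0 u : sorted leq u -> word_inv u = 0%N.
  elim: u => //= x u IHu x_u; rewrite IHu ?(path_sorted x_u) // addn0.
  apply/eqP; rewrite -leqn0 leqNgt -has_count; apply/hasPn => y.
  by move/(allP (order_path_min leq_trans x_u)); rewrite /= -leqNgt.
rewrite /Acoef (big_rem w) ?mem_permutations //= big_seq big1 => [|u].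
  rewrite inv0 // mul1r addr0 /M_; congr (_%:R); congr nat_of_bool.
  apply/asboolP/eqP => [[i [si i_srt]]|->].
    move/esym=> eq_w; apply: power_word_inj eq_w => //.
    by rewrite size_iota.
  by exists (iota 0 (size b)); rewrite size_iota.
rewrite mem_rem_uniq ?permutations_uniq // inE mem_permutations.
case/andP=> u_w perm_u; rewrite /M_.
case: asboolP => [[i [_ i_srt u_E]]|_]; last by rewrite mulr0.
case/eqP: u_w; apply: (sorted_eq leq_trans anti_leq) => //.
by rewrite u_E power_word_sorted.
Qed.

Definition S_dual_basis (Sdual : seq nat -> NSym) : Prop :=
  forall a b : seq nat, is_comp a -> is_comp b ->
    pairing (S_ a) (Sdual b) = (a == b)%:R.

End Algebras.

(* Main.v *)
Require Import Defs.
From mathcomp Require Import all_boot all_order all_algebra.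
From mathcomp Require Import finmap monalg.
From mathcomp Require Import boolp.
From mathcomp Require Import zify.

Set Implicit Arguments.
Unset Strict Implicit.
Unset Printing Implicit Defensive.

(** Both rules are one statement about column words.  A standard Young
    composition tableau of shape b is a saturated chain from the empty
    composition to b, since its largest entry sits in a box whose removal is a
    cover of the composition poset; and the column sequence w of the chain
    determines the chain ([mem_SYCT]).  In these terms inv^c is the number of
    inversions of w, and the descents are the places where w fails to increase.
    Hence the pairing of S_b with H_c is, up to the sign of b, the signed number
    of words w of shape b that increase on consecutive blocks of lengths c
    ([pairing_S]).

    Multiplication on the right by H_n adds a last block, so the last n letters
    of w must increase.  Multiplication by the alternating sum E_n of the
    products of the H_i of degree n forces them, by inclusion and exclusion, to
    decrease weakly ([sum_blocks]).  Cutting w before its last n letters yields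
    a word of some shape a and a chain from a to b with a sorted column
    sequence.  Such a chain is unique if it exists: its letters form a fixed
    multiset, so the sorted column sequence is determined, and with it the
    chain ([run_sorted_inj]).  This gives the expansion of the pairings of S_b
    with g H_n and g E_n in those of the S_a with g, up to signs ([pieri_H]).

    For the signs, sort all parts: the same column word describes a chain of
    partitions from the sorted a to the sorted b ([sort_run]).  If the boxes of
    a partition are added one by one, NE counts the inversions of the row word
    plus those of the column word ([npairs_growth]).  The row word of
    (T_lambda)_S has the sign that enters oc, and the column words account for
    the signs of the S_b ([sign_run]).

    It remains to see that oc has a single term.  Jeu de taquin preserves
    descents ([ascents_rect]), and the only standard tableau of straight shape
    whose column word increases, respectively decreases weakly, is a row,
    respectively a column.  So the fillings of rectification T_(n) or T_(1^n)
    are the fillings with a sorted column word, and there is one such filling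
    ([oc_run]).

    Finally H_n and E_n are the dual basis elements of (n) and (1^n)
    ([pairing_shape]), and elements of NSym with equal pairings with all S_b
    are equal ([pairing_inj]). *)

(** * Diagrams grown one box at a time *)

(** The columns in which a box can be added to a shape: the first one, or the
    one to the right of an existing row end. *)
Definition addable (a : seq nat) (c : nat) : bool := (c == 0) || (c \in a).

(** A rule naming the row that receives a box added in column [c].  The rule
    [lrow] gives the covers of the composition poset, [frow] those of Young's
    lattice; both raise a part [c] to [c.+1], hence agree up to sorting. *)
Definition selects (rho : seq nat -> nat -> nat) : Prop :=
  forall a c, is_comp a -> addable a c ->
    nth 0 a (rho a c) = c /\ rho a c <= size a.

(** The last row of length [c], where the rows past the end have length 0. *)
Fixpoint lrow (a : seq nat) (c : nat) : nat :=
  if a is _ :: a' then if addable a' c then (lrow a' c).+1 else 0 else 0.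

Definition frow (a : seq nat) (c : nat) : nat := index c a.

Definition add_box (rho : seq nat -> nat -> nat) a c :=
  set_nth 0 a (rho a c) c.+1.

Definition run rho : seq nat -> seq nat -> seq nat := foldl (add_box rho).

Fixpoint addables rho a cs : bool :=
  if cs is c :: cs' then addable a c && addables rho (add_box rho a c) cs'
  else true.

Fixpoint tab rho a cs : seq box :=
  if cs is c :: cs' then (rho a c, c) :: tab rho (add_box rho a c) cs'
  else [::].

Lemma comp_nth a i : is_comp a -> i < size a -> 0 < nth 0 a i.
Proof. by move=> /allP a_c lt_i; apply/a_c/mem_nth. Qed.

Lemma comp_nth0 a i : is_comp a -> nth 0 a i = 0 -> size a <= i.
Proof. by move=> a_c; case: leqP => // /(comp_nth a_c) /lt0n_neq0/eqP. Qed.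

Lemma lrow_selects : selects lrow.
Proof.
elim=> [|x a IHa] c; first by rewrite /addable orbF => _ /eqP ->.
move=> a_c; have a_c' : is_comp a by case/andP: a_c.
rewrite /=; case: ifP => [ad_c _|]; first exact: IHa.
by rewrite /addable inE /= => /norP[/negbTE-> /negbTE->]; rewrite orbF => /eqP ->.
Qed.

Lemma lrow_last a c i : is_comp a -> 0 < c -> lrow a c < i -> nth 0 a i != c.
Proof.
move=> a_c c_gt0; elim: a a_c i => [|x a IHa] a_c i /=.
  by rewrite nth_nil eq_sym -lt0n.
case: i => // i; have {a_c} : is_comp a by case/andP: a_c.
case: ifP => [_ /IHa IH|ad_c _]; first by rewrite ltnS => /IH.
move=> _ /=; apply: contraFneq ad_c => ith; rewrite /addable -ith orbC mem_nth //.
by rewrite ltnNge; apply: contraL c_gt0 => /(nth_default 0); rewrite ith => ->.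
Qed.

(** Past the end of a composition the index is the size, so column 0 starts a
    new row with this rule too. *)
Lemma frow_selects : selects frow.
Proof.
move=> a c a_c ad_c; rewrite /frow index_size; split=> //.
case/orP: ad_c => [/eqP->|c_a]; last exact: nth_index.
case: (boolP (0 \in a)) => [|z_a]; first exact: nth_index.
by rewrite memNindex // nth_default.
Qed.

Lemma selects_row0 rho a : selects rho -> is_comp a -> rho a 0 = size a.
Proof.
move=> rho_s a_c; have [//|rho0 le_rho] := rho_s a 0 a_c.
by apply/eqP; rewrite eqn_leq le_rho comp_nth0.
Qed.

Lemma selects_size rho a c :
  selects rho -> is_comp a -> addable a c -> 0 < c -> rho a c < size a.
Proof.
move=> rho_s a_c ad_c c_gt0; have [] := rho_s a c a_c ad_c.
rewrite leq_eqVlt => rhoE /orP[/eqP eq_s|//].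
by move: rhoE c_gt0; rewrite eq_s nth_default // => <-.
Qed.

Lemma nth_add_box rho a c i : selects rho -> is_comp a -> addable a c ->
  nth 0 (add_box rho a c) i = nth 0 a i + (i == rho a c).
Proof.
move=> rho_s a_c ad_c; rewrite nth_set_nth /=.
by case: eqP => [->|_]; rewrite ?addn0 // (rho_s a c a_c ad_c).1 addn1.
Qed.

Lemma size_add_box rho a c : selects rho -> is_comp a -> addable a c ->
  size (add_box rho a c) = size a + (c == 0).
Proof.
move=> rho_s a_c ad_c; rewrite size_set_nth; case: c ad_c => [|c] ad_c /=.
  by rewrite selects_row0 //; lia.
by have := selects_size rho_s a_c ad_c isT; lia.
Qed.

Lemma add_box_comp rho a c : selects rho -> is_comp a -> addable a c ->
  is_comp (add_box rho a c).
Proof.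
move=> rho_s a_c ad_c; apply/(all_nthP 0) => i.
rewrite size_add_box // nth_add_box // => lt_i.
have [lt_ia|ge_ia] := ltnP i (size a); first by rewrite addn_gt0 comp_nth.
case: eqP lt_i => [c0|]; last lia.
by rewrite c0 selects_row0 //; lia.
Qed.

Lemma perm_set_nth (x : nat) s k y : k < size s ->
  perm_eq (nth x s k :: set_nth x s k y) (y :: s).
Proof.
elim: s k => [|z s IHs] [|k] //= lt_k; apply/permP => P /=; first lia.
by have /permP/(_ P) := IHs k lt_k; rewrite /=; lia.
Qed.

(** Whatever the row, one part [c] becomes [c.+1]; for [c = 0] there is no
    part to remove, and [rem] does nothing. *)
Lemma add_box_perm rho a c : selects rho -> is_comp a -> addable a c ->
  perm_eq (add_box rho a c) (c.+1 :: rem c a).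
Proof.
move=> rho_s a_c; rewrite /add_box; case: (posnP c) => [->|c_gt0] ad_c.
  rewrite selects_row0 // rem_id; last by apply/negP => /(allP a_c).
  suff -> : set_nth 0 a (size a) 1 = rcons a 1 by rewrite perm_rcons.
  by elim: (a) => //= x s ->.
have [nth_c _] := rho_s a c a_c ad_c.
have lt_c := selects_size rho_s a_c ad_c c_gt0.
have /perm_to_rem/permP c_a : c \in a by rewrite -nth_c mem_nth.
have /permP set_c := perm_set_nth 0 c.+1 lt_c.
by apply/permP => P; have := c_a P; have := set_c P; rewrite nth_c /=; lia.
Qed.

Lemma mem_boxes a b : (b \in boxes a) = (b.2 < nth 0 a b.1).
Proof.
case: b => i j /=; apply/allpairsPdep/idP => [[i' [j' [+ + [-> ->]]]]|lt_j].
  by rewrite !mem_iota add0n => _ /=.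
exists i, j; split=> //; rewrite mem_iota //= add0n ltnNge.
by apply: contraL lt_j => /(nth_default 0) ->.
Qed.

Lemma boxes_uniq a : uniq (boxes a).
Proof.
apply: allpairs_uniq_dep => [|i _|]; try exact: iota_uniq.
by move=> [i j] [i' j'] _ _ /= [-> ->].
Qed.

(** Compositions have no zero parts, so their diagrams determine their size as
    well as their parts. *)
Lemma boxes_inj a b : is_comp a -> is_comp b -> boxes a =i boxes b -> a = b.
Proof.
move=> a_c b_c eq_ab.
have eq_nth i : nth 0 a i = nth 0 b i.
  have H j := eq_ab (i, j); have := H (nth 0 a i); have := H (nth 0 b i).
  by rewrite !mem_boxes /= !ltnn; lia.
apply: (@eq_from_nth _ 0) => //; apply/eqP; rewrite eqn_leq.
apply/andP; split; apply: comp_nth0 => //; first by rewrite eq_nth nth_default.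
by rewrite -eq_nth nth_default.
Qed.

Lemma size_boxes a : size (boxes a) = sumn a.
Proof.
rewrite size_allpairs_dep; under eq_map do rewrite size_iota.
by rewrite (map_nth_iota0 0) ?take_size.
Qed.

Lemma boxes_add_box rho a c : selects rho -> is_comp a -> addable a c ->
  perm_eq (boxes (add_box rho a c)) ((rho a c, c) :: boxes a).
Proof.
move=> rho_s a_c ad_c; have [nth_c _] := rho_s a c a_c ad_c.
apply: uniq_perm; rewrite ?boxes_uniq //= ?boxes_uniq ?andbT.
  by rewrite mem_boxes /= nth_c ltnn.
move=> [i j]; rewrite inE !mem_boxes nth_add_box // xpair_eqE /=.
by case: eqP => [->|_]; rewrite ?nth_c ?addn0 // addn1 ltnS leq_eqVlt.
Qed.

Lemma run_comp rho a cs : selects rho -> is_comp a -> addables rho a cs ->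
  is_comp (run rho a cs).
Proof.
move=> rho_s; elim: cs a => //= c cs IHcs a a_c /andP[ad_c].
exact/IHcs/add_box_comp.
Qed.

Lemma boxes_run rho a cs : selects rho -> is_comp a -> addables rho a cs ->
  perm_eq (boxes (run rho a cs)) (boxes a ++ tab rho a cs).
Proof.
move=> rho_s; elim: cs a => [|c cs IHcs] a a_c /=; first by rewrite cats0.
case/andP=> ad_c /(IHcs _ (add_box_comp rho_s a_c ad_c)) /permP boxesE.
have /permP box1 := boxes_add_box rho_s a_c ad_c.
apply/permP => P; have := boxesE P; have := box1 P.
by rewrite !count_cat /=; lia.
Qed.

Lemma unzip2_tab rho a cs : unzip2 (tab rho a cs) = cs.
Proof. by elim: cs a => //= c cs IHcs a; rewrite IHcs. Qed.

Lemma size_tab rho a cs : size (tab rho a cs) = size cs.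
Proof. by rewrite -[RHS](congr1 size (unzip2_tab rho a cs)) size_map. Qed.

Lemma run_cat rho a u v : run rho a (u ++ v) = run rho (run rho a u) v.
Proof. exact: foldl_cat. Qed.

Lemma addables_cat rho a u v :
  addables rho a (u ++ v) = addables rho a u && addables rho (run rho a u) v.
Proof. by elim: u a => //= c u IHu a; rewrite IHu andbA. Qed.

Lemma tab_cat rho a u v : tab rho a (u ++ v) = tab rho a u ++ tab rho (run rho a u) v.
Proof. by elim: u a => //= c u IHu a; rewrite IHu. Qed.

Lemma sumn_run rho a cs : selects rho -> is_comp a -> addables rho a cs ->
  sumn (run rho a cs) = sumn a + size cs.
Proof.
move=> rho_s a_c ad_cs; rewrite -!size_boxes (perm_size (boxes_run rho_s a_c ad_cs)).
by rewrite size_cat size_tab.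
Qed.

Lemma run_perm rho a u v : selects rho -> is_comp a ->
    addables rho a u -> addables rho a v -> run rho a u = run rho a v ->
  perm_eq u v.
Proof.
move=> rho_s a_c ad_u ad_v eq_uv; have := boxes_run rho_s a_c ad_u.
rewrite eq_uv (permPl (boxes_run rho_s a_c ad_v)) perm_cat2l => /(perm_map snd).
by rewrite -!/(unzip2 _) !unzip2_tab perm_sym.
Qed.

(** A skew shape has at most one filling whose column word is sorted: all its
    column words have the same letters, and a word determines its filling. *)
Lemma run_sorted_inj rho (r : rel nat) a u v : selects rho -> is_comp a ->
    transitive r -> antisymmetric r -> sorted r u -> sorted r v ->
    addables rho a u -> addables rho a v -> run rho a u = run rho a v ->
  u = v.
Proof.
move=> rho_s a_c r_tr r_anti r_u r_v ad_u ad_v eq_uv.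
exact: (sorted_eq r_tr r_anti r_u r_v (run_perm rho_s a_c ad_u ad_v eq_uv)).
Qed.

Lemma perm_addable a b c : perm_eq a b -> addable a c = addable b c.
Proof. by move=> /perm_mem eq_ab; rewrite /addable eq_ab. Qed.

Lemma perm_comp a b : perm_eq a b -> is_comp a = is_comp b.
Proof. exact: perm_all. Qed.

Lemma perm_add_box rho rho' a b c : selects rho -> selects rho' ->
    is_comp a -> addable a c -> perm_eq a b ->
  perm_eq (add_box rho a c) (add_box rho' b c).
Proof.
move=> rho_s rho_s' a_c ad_c eq_ab.
have b_c : is_comp b by rewrite -(perm_comp eq_ab).
have ad_b : addable b c by rewrite -(perm_addable _ eq_ab).
rewrite (permPl (add_box_perm rho_s a_c ad_c)) perm_sym.
rewrite (permPl (add_box_perm rho_s' b_c ad_b)) perm_cons.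
by apply/permP => P; rewrite !count_rem -(permP eq_ab P) -(perm_mem eq_ab).
Qed.

(** The two row rules add the same multiset of parts, so they can be followed
    in parallel on sorted and unsorted shapes. *)
Lemma perm_run rho rho' a b cs : selects rho -> selects rho' ->
    is_comp a -> perm_eq a b -> addables rho a cs ->
  addables rho' b cs /\ perm_eq (run rho a cs) (run rho' b cs).
Proof.
move=> rho_s rho_s'; elim: cs a b => //= c cs IHcs a b a_c eq_ab /andP[ad_c ad_cs].
rewrite -(perm_addable _ eq_ab) ad_c /=.
by apply: IHcs; rewrite ?add_box_comp //; apply: perm_add_box.
Qed.

Definition is_part (l : seq nat) : bool := is_comp l && sorted geq l.

Lemma geq_trans : transitive geq.
Proof. by move=> x y z /= le1 le2; apply: leq_trans le1. Qed.

Lemma geq_anti : antisymmetric geq.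
Proof. by move=> x y; rewrite andbC; apply: anti_leq. Qed.

Lemma sort_comp_part a : is_comp a -> is_part (sort_comp a).
Proof.
move=> a_c; rewrite /is_part sort_sorted ?andbT; last by move=> x y; apply: leq_total.
by rewrite (perm_comp (permEl (perm_sort _ _))).
Qed.

Lemma part_sort l : is_part l -> sort_comp l = l.
Proof. by case/andP=> _ s_l; apply: sorted_sort geq_trans _ s_l. Qed.

Lemma part_nth l i j : is_part l -> i <= j -> nth 0 l j <= nth 0 l i.
Proof.
case/andP=> _ s_l le_ij; have [ge_j|lt_j] := leqP (size l) j.
  by rewrite nth_default.
have lt_i := leq_ltn_trans le_ij lt_j.
by have := @sorted_leq_nth _ geq geq_trans leqnn 0 l s_l i j lt_i lt_j le_ij.
Qed.

Lemma frow_first l c i : i < frow l c -> nth 0 l i != c.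
Proof. by move/(before_find 0) => /= /negbT. Qed.

Lemma add_box_part l c : is_part l -> addable l c -> is_part (add_box frow l c).
Proof.
move=> l_p ad_c; have l_c : is_comp l by case/andP: l_p.
rewrite /is_part add_box_comp //=; last exact: frow_selects.
apply/(sortedP 0) => i _; rewrite !nth_add_box //=; try exact: frow_selects.
have := part_nth l_p (leqnSn i); case: (i.+1 =P _) => [eq_i|_]; last lia.
have := @frow_first l c i; rewrite -eq_i ltnSn => /(_ isT).
by have := (frow_selects l_c ad_c).1; rewrite -eq_i; lia.
Qed.

Lemma run_part l cs : is_part l -> addables frow l cs -> is_part (run frow l cs).
Proof.
by elim: cs l => //= c cs IHcs l l_p /andP[ad_c]; apply/IHcs/add_box_part.
Qed.

(** Sorting the parts turns a chain of compositions into a chain of partitions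
    with the same column sequence. *)
Lemma sort_run a cs : is_comp a -> addables lrow a cs ->
  addables frow (sort_comp a) cs /\ sort_comp (run lrow a cs) = run frow (sort_comp a) cs.
Proof.
move=> a_c ad_cs; have sort_a : perm_eq a (sort_comp a).
  by rewrite perm_sym; apply/permEl/perm_sort.
have [ad_s eq_s] := perm_run lrow_selects frow_selects a_c sort_a ad_cs.
split=> //; rewrite -[RHS]part_sort; last by apply/run_part => //; apply: sort_comp_part.
apply/(perm_sortP _ geq_trans geq_anti) => // x y; exact: leq_total.
Qed.

(** * Growth of order ideals and jeu de taquin *)

Definition ideal (I : seq box) : Prop :=
  forall b c : box, c.1 <= b.1 -> c.2 <= b.2 -> b \in I -> c \in I.

(** The boxes of [S], added to [I] in this order, give an order ideal at every
    step.  This is standardness of a filling, in a form that jeu de taquin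
    visibly preserves. *)
Fixpoint growth (I S : seq box) : Prop :=
  if S is b :: S' then [/\ b \notin I, ideal (b :: I) & growth (b :: I) S']
  else True.

Lemma eq_ideal I J : I =i J -> ideal I -> ideal J.
Proof. by move=> eq_IJ I_id b c le1 le2; rewrite -!eq_IJ; apply: I_id. Qed.

Lemma eq_growth I J S : I =i J -> growth I S -> growth J S.
Proof.
elim: S I J => //= b S IHS I J eq_IJ [b_I bI_id gr_S].
have eq_bIJ : b :: I =i b :: J by move=> c; rewrite !inE eq_IJ.
split; [by rewrite -eq_IJ | exact: eq_ideal bI_id | exact: IHS gr_S].
Qed.

Lemma growth_cat I s t : growth I (s ++ t) <-> growth I s /\ growth (rev s ++ I) t.
Proof.
elim: s I => [|b s IHs] I /=; first by split=> // -[].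
rewrite rev_cons cat_rcons; split=> [[b_I bI_id /IHs[gr_s gr_t]]|] //.
by case=> [[b_I bI_id gr_s] gr_t]; split=> //; apply/IHs.
Qed.

Lemma ideal_boxes l : is_part l -> ideal (boxes l).
Proof.
move=> l_p b c le1 le2; rewrite !mem_boxes => lt_b.
exact: leq_ltn_trans le2 (leq_trans lt_b (part_nth l_p le1)).
Qed.

(** The prefixes of the row reading order are the diagrams of partitions. *)
Lemma growth_boxes l : is_part l -> growth [::] (boxes l).
Proof.
have boxes_rcons l' p : boxes (rcons l' p) = boxes l' ++ [seq (size l', j) | j <- iota 0 p].
  rewrite /boxes size_rcons -addn1 iotaD map_cat flatten_cat /= cats0 add0n.
  rewrite nth_rcons ltnn eqxx; congr (flatten _ ++ _); apply/eq_in_map => i.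
  by rewrite mem_iota add0n => /= lt_i; rewrite nth_rcons lt_i.
elim/last_ind: l => // l p IHl lp_p.
have part_q q : 0 < q <= p -> is_part (rcons l q).
  move: lp_p; rewrite /is_part /is_comp !all_rcons -andbA => /and3P[_ -> s_lp].
  case/andP=> -> le_q /=; case: (l) s_lp => //= x s; rewrite !rcons_path => /andP[-> /=].
  exact: leq_trans.
have l_p : is_part l.
  move: lp_p; rewrite /is_part /is_comp all_rcons -andbA => /and3P[_ -> /=].
  by rewrite -cats1 => /cat_sorted2[].
rewrite boxes_rcons; elim: p {lp_p} part_q => [|p IHp] part_q.
  by rewrite cats0; apply: IHl.
rewrite -[p.+1]addn1 iotaD map_cat catA -boxes_rcons.
apply/growth_cat; split=> /=.
  by rewrite boxes_rcons; apply: IHp => q /andP[q0 le_q]; rewrite part_q // q0 leqW.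
split=> //; first by rewrite cats0 mem_rev mem_boxes nth_rcons ltnn eqxx /= add0n ltnn.
apply: eq_ideal (ideal_boxes (part_q p.+1 _)) => //= b.
rewrite cats0 inE mem_rev !boxes_rcons -[p.+1]addn1 iotaD map_cat /=.
by rewrite !mem_cat !inE orbA orbC.
Qed.

(** In a partition a box can be added only at the end of the first row of its
    length. *)
Lemma ideal_add l b : is_part l -> b \notin boxes l -> ideal (b :: boxes l) ->
  addable l b.2 /\ b = (frow l b.2, b.2).
Proof.
case: b => r c l_p; rewrite mem_boxes /= -leqNgt => le_c id_b.
have l_c : is_comp l by case/andP: l_p.
have nth_r : nth 0 l r = c.
  apply/eqP; rewrite eqn_leq le_c leqNgt /=; apply/negP => lt_c.
  have := id_b (r, c) (r, nth 0 l r); rewrite !inE eqxx /= => /(_ (leqnn _) le_c isT).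
  by rewrite xpair_eqE eqxx mem_boxes /= ltnn orbF; lia.
have nth_lt i : i < r -> c < nth 0 l i.
  move=> lt_i; have := id_b (r, c) (i, c); rewrite !inE eqxx /= leqnn.
  move=> /(_ (ltnW lt_i) isT isT); rewrite xpair_eqE mem_boxes /=.
  by rewrite (ltn_eqF lt_i).
have le_r : r <= size l.
  case: r {nth_r id_b le_c} nth_lt => // r /(_ r (ltnSn r)).
  by case: (ltnP r (size l)) => // /(nth_default 0) ->.
have ad_c : addable l c.
  move: le_r; rewrite leq_eqVlt => /orP[/eqP eq_r|lt_r].
    by rewrite /addable -nth_r eq_r nth_default.
  by rewrite /addable -nth_r mem_nth ?orbT.
split=> //; congr (_, _).
have [nth_f _] := frow_selects l_c ad_c.
case: (ltngtP r (frow l c)) => // [/frow_first/eqP|/nth_lt]; first by [].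
by rewrite nth_f ltnn.
Qed.

(** Standard fillings of a skew shape amount to column words. *)
Lemma growth_tab l S : is_part l ->
  growth (boxes l) S <-> addables frow l (unzip2 S) /\ S = tab frow l (unzip2 S).
Proof.
elim: S l => [|b S IHS] l l_p //=.
have l_c : is_comp l by case/andP: l_p.
have add_mem c : addable l c ->
    boxes (add_box frow l c) =i (frow l c, c) :: boxes l.
  by move=> ad_c; apply/perm_mem/boxes_add_box => //; apply: frow_selects.
case: b => r c; split=> /= [[b_l id_b gr_S]|[/andP[ad_c ad_S] [-> eq_S]]].
  have [/= ad_c [eq_r]] := ideal_add l_p b_l id_b; rewrite ad_c /= -eq_r.
  have [|-> <- //] := (IHS _ (add_box_part l_p ad_c)).1 _.
  by apply: eq_growth gr_S => x; rewrite add_mem // -eq_r.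
split.
- by rewrite mem_boxes /= (frow_selects l_c ad_c).1 ltnn.
- exact: eq_ideal (add_mem _ ad_c) (ideal_boxes (add_box_part l_p ad_c)).
apply: eq_growth (add_mem _ ad_c) _.
by apply/(IHS _ (add_box_part l_p ad_c)).
Qed.

(** At each moment of the slide, the scanned boxes form an order ideal with the
    hole and also without it; a box that does not move can be added to either
    ideal, and one that moves fills the hole. *)
Lemma growth_slide I h t : h \notin I -> ideal I -> ideal (h :: I) ->
  growth (h :: I) t -> growth I (jdt_slide h t).
Proof.
elim: t I h => [|b t IHt] I h h_I I_id hI_id //= [b_hI bhI_id gr_t].
move: b_hI; rewrite inE negb_or => /andP[ne_bh b_I].
case: ifP => [_|/norP[not_r not_d]] /=.
  by split=> //; apply: IHt => //; rewrite inE negb_or ne_bh.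
have eq_hb : h :: b :: I =i b :: h :: I by move=> c; rewrite !inE orbCA.
have bI_id : ideal (b :: I).
  move=> c d le1 le2; rewrite !inE => c_bI.
  have := bhI_id c d le1 le2; rewrite !inE => d_bhI.
  have {d_bhI}: [|| d == b, d == h | d \in I].
    by apply: d_bhI; case/orP: c_bI => ->; rewrite ?orbT.
  case/or3P=> [->|/eqP eq_d|->]; rewrite ?orbT //; subst d.
  case/orP: c_bI => [/eqP eq_c|c_I]; last by rewrite (I_id _ _ le1 le2 c_I) in h_I.
  subst c.
  (* A scanned box between the hole and [b] would put the hole into [I]. *)
  have next x : x.1 <= b.1 -> x.2 <= b.2 -> h.1 <= x.1 -> h.2 <= x.2 ->
      x != b -> x != h -> (h == b) || (h \in I).
    move=> le_x1 le_x2 le_h1 le_h2 ne_xb ne_xh.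
    have := bhI_id b x le_x1 le_x2; rewrite !inE eqxx => /(_ isT).
    rewrite (negbTE ne_xb) (negbTE ne_xh) => x_I.
    by rewrite (I_id _ _ le_h1 le_h2 x_I) orbT.
  case: (ltnP h.1 b.1) => [lt_h|ge_h].
    apply: (next (h.1.+1, h.2)) => //=; first by rewrite eq_sym.
    by apply/eqP => /(congr1 fst) /=; lia.
  have eq_h : b.1 = h.1 by apply/eqP; rewrite eqn_leq ge_h.
  apply: (next (h.1, h.2.+1)) => //=; last 1 first.
  - by apply/eqP => /(congr1 snd) /=; lia.
  - rewrite ltn_neqAle le2 andbT; apply: contra ne_bh => /eqP eq_h2.
    by rewrite [b]surjective_pairing eq_h -eq_h2 -surjective_pairing.
  by rewrite eq_sym.
split=> //; apply: IHt => //; first by rewrite inE negb_or eq_sym ne_bh.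
  by apply: eq_ideal bhI_id => c; rewrite eq_hb.
by apply: eq_growth gr_t => c; rewrite eq_hb.
Qed.

Definition moves (h b : box) : bool :=
  (b == (h.1, h.2.+1)) || (b == (h.1.+1, h.2)).

(** Columns change only by moves to the left.  So the order of the columns of
    [b] and [c], scanned in this order with the hole at [h], could change only
    if [b] moves left and [c] lies in its column, if [c] moves left and [b]
    lies in the column of the hole, or if the hole turns a corner.  The order
    ideals exclude this: a box scanned out of turn or one next to the hole
    would have to be present already. *)
Lemma slide_ascent I h b c :
    h \notin I -> ideal I -> ideal (h :: I) ->
    b \notin h :: I -> ideal (b :: h :: I) ->
    c \notin b :: h :: I -> ideal (c :: b :: h :: I) ->
  let h' := if moves h b then b else h in
  ((if moves h b then h else b).2 < (if moves h' c then h' else c).2)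
    = (b.2 < c.2).
Proof.
case: h b c => [p q] [b1 b2] [c1 c2] h_I I_id hI_id b_hI bhI_id c_bhI cbhI_id.
have inI u v : p <= u -> q <= v -> (u, v) \notin I.
  move=> le1 le2; apply: contra h_I; exact: I_id.
have below_c u v : u <= c1 -> v <= c2 -> p <= u -> q <= v ->
    u = c1 /\ v = c2 \/ u = b1 /\ v = b2 \/ u = p /\ v = q.
  move=> le1 le2 /inI uI /uI /negbTE uI'.
  have := cbhI_id (c1, c2) (u, v) le1 le2; rewrite !inE eqxx uI' !xpair_eqE => /(_ isT).
  by case/or4P => // /andP[/eqP -> /eqP ->]; tauto.
have below_b u v : u <= b1 -> v <= b2 -> p <= u -> q <= v ->
    u = b1 /\ v = b2 \/ u = p /\ v = q.
  move=> le1 le2 /inI uI /uI /negbTE uI'.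
  have := bhI_id (b1, b2) (u, v) le1 le2; rewrite !inE eqxx uI' !xpair_eqE => /(_ isT).
  by case/or3P => // /andP[/eqP -> /eqP ->]; tauto.
have c_nle_b : ~ (c1 <= b1 /\ c2 <= b2).
  by case=> le1 le2; move/negP: c_bhI; apply; apply: (bhI_id (b1, b2)); rewrite // inE eqxx.
have b_nle_h : ~ (b1 <= p /\ b2 <= q).
  by case=> le1 le2; move/negP: b_hI; apply; apply: (hI_id (p, q)); rewrite // inE eqxx.
(* Only boxes next to the hole matter. *)
have c10 := below_c p.+1 q; have c01 := below_c p q.+1.
have c11 := below_c p.+1 q.+1; have b10 := below_b p.+1 q.
clear - c_nle_b b_nle_h c10 c01 c11 b10.
rewrite /moves !xpair_eqE /=.
case: ifP => mb; rewrite ?xpair_eqE /=; case: ifP => mc /=; lia.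
Qed.

Definition ascents (t : seq box) : seq bool :=
  if t is b :: t' then pairmap (fun b c : box => b.2 < c.2) b t' else [::].

(** Jeu de taquin preserves descents. *)
Lemma ascents_slide I h t : h \notin I -> ideal I -> ideal (h :: I) ->
  growth (h :: I) t -> ascents (jdt_slide h t) = ascents t.
Proof.
elim: t I h => [|b t IHt] I h h_I I_id hI_id //= [b_hI bhI_id gr_t].
have eq_hb : h :: b :: I =i b :: h :: I by move=> c; rewrite !inE orbCA.
have [bI_id step] : (moves h b = false -> ideal (b :: I)) /\
    ascents (jdt_slide (if moves h b then b else h) t) = ascents t.
  have := @growth_slide I h [:: b] h_I I_id hI_id; rewrite /= -/(moves h b).
  case: ifP => mb [] // => [_ _ _|b_I bI_id _]; split=> //.
    exact: IHt gr_t.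
  apply: (IHt (b :: I)) => //.
  - by rewrite inE negb_or h_I andbT; move: b_hI; rewrite inE eq_sym => /norP[].
  - exact: eq_ideal (fsym eq_hb) bhI_id.
  - by apply: eq_growth gr_t => c; rewrite eq_hb.
case: t gr_t step {IHt} => [|c t] /=; first by case: ifP.
case=> c_bhI cbhI_id _; rewrite -!/(moves _ _).
have := slide_ascent h_I I_id hI_id b_hI bhI_id c_bhI cbhI_id.
by case: ifP => mb /=; case: ifP => mc /= eq_bc <-; congr (_ :: _).
Qed.

(** Rectification slides into the boxes of the inner shape in the reverse of an
    order of growth, so each hole is a corner of an order ideal. *)
Lemma ascents_rect I s t : ideal I -> growth I s -> growth (rev s ++ I) t ->
  growth I (foldr jdt_slide t s) /\ ascents (foldr jdt_slide t s) = ascents t.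
Proof.
elim: s I => [|b s IHs] I I_id //= [b_I bI_id gr_s].
rewrite rev_cons cat_rcons => /(IHs _ bI_id gr_s)[gr_t <-].
by split; [exact: growth_slide | exact: ascents_slide gr_t].
Qed.

Lemma sorted_ascents t :
  sorted ltn (unzip2 t) = all id (ascents t) /\
  sorted geq (unzip2 t) = all negb (ascents t).
Proof.
case: t => //= b t; elim: t b => //= c t IHt b.
by have [-> ->] := IHt c; rewrite -leqNgt.
Qed.

Lemma ideal_nil : ideal [::]. Proof. by []. Qed.

(** * Skew tableaux and the coefficients oc *)

(** A filling of a set of boxes is a growth if every box comes after those
    weakly to its northwest. *)
Lemma growth_order I S : ideal I -> uniq S -> {in S, forall b, b \notin I} ->
    (forall b c, b \in S -> c.1 <= b.1 -> c.2 <= b.2 ->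
       c \in I \/ c \in S /\ index c S <= index b S) ->
  growth I S.
Proof.
elim: S I => //= b S IHS I I_id /andP[b_S S_u] S_I S_le.
have bI_id : ideal (b :: I).
  move=> d c le1 le2; rewrite !inE => /orP[/eqP eq_d|d_I]; last first.
    by rewrite (I_id d) ?orbT.
  subst d; have [|->|[_]] := S_le b c _ le1 le2; rewrite ?orbT ?inE ?eqxx //.
  by rewrite eq_sym; case: eqP.
split=> //; first by rewrite S_I // inE eqxx.
apply: IHS => // [d d_S|d c d_S le1 le2].
  rewrite inE negb_or S_I ?inE ?d_S ?orbT // andbT.
  by apply: contraNneq b_S => <-.
have [|c_I|[]] := S_le d c _ le1 le2; rewrite ?inE ?d_S ?orbT //.
  by left; rewrite c_I orbT.
have [->|ne_bc] := eqVneq b c; first by left.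
move=> /= c_S.
have [eq_bd|_] := eqVneq b d; last by rewrite ltnS; right.
by move: b_S; rewrite eq_bd d_S.
Qed.

Lemma growth_index I S : ideal I -> growth I S -> forall b c,
    b \in S -> c.1 <= b.1 -> c.2 <= b.2 ->
  c \in I \/ c \in S /\ index c S <= index b S.
Proof.
elim: S I => //= a S IHS I I_id [a_I aI_id gr_S] b c b_aS le1 le2.
have := aI_id b c le1 le2; rewrite !inE.
have [->|ne_ab] := eqVneq a b.
  by move=> /(_ isT)/orP[/eqP ->|]; [right; rewrite !eqxx | left].
move: b_aS; rewrite inE eq_sym (negbTE ne_ab) /= => b_S _.
have [] := IHS _ aI_id gr_S b c b_S le1 le2; rewrite ?inE.
  by case/orP=> [/eqP ->|]; [right; rewrite eqxx | left].
by case=> c_S le_i; right; rewrite c_S orbT; case: eqP.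
Qed.

Lemma perm_cat_uniq (u s t : seq box) : uniq u -> perm_eq u (s ++ t) ->
  uniq t /\ {in t, forall b, b \notin s}.
Proof.
move=> u_u /perm_uniq; rewrite u_u cat_uniq => /esym/and3P[_ /hasPn s_t ->].
by split=> // b /s_t.
Qed.

(** The rows and columns of a filling increase exactly when each box follows
    those weakly to its northwest; the corner box [(c.1, b.2)] links the row
    and the column condition. *)
Lemma mem_skew_SYT l v S : is_part l -> is_part v ->
  S \in skew_SYT v l <-> growth (boxes l) S /\ perm_eq (boxes v) (boxes l ++ S).
Proof.
move=> l_p v_p; have id_l := ideal_boxes l_p; rewrite /skew_SYT.
have sub_perm : all [in boxes v] (boxes l) ->
    perm_eq (boxes v) (boxes l ++ [seq b <- boxes v | b \notin boxes l]).
  move=> /allP sub; apply: uniq_perm; rewrite ?boxes_uniq // ?cat_uniq.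
    rewrite !boxes_uniq filter_uniq ?boxes_uniq ?andbT //=.
    by apply/hasPn => b; rewrite mem_filter => /andP[].
  move=> b; rewrite mem_cat mem_filter; case: (boolP (b \in boxes l)) => //=.
  by move/sub.
split.
  case: ifP => // sub; rewrite mem_filter mem_permutations.
  case/andP=> /andP[/allrelP S_row /allrelP S_col] S_perm.
  have perm_S : perm_eq (boxes v) (boxes l ++ S).
    by rewrite (permPl (sub_perm sub)) perm_cat2l perm_sym.
  have [S_u S_l] := perm_cat_uniq (boxes_uniq v) perm_S.
  split=> //; apply: growth_order => // b c b_S le1 le2.
  have mem_v x : x \in boxes v = (x \in boxes l) || (x \in S).
    by rewrite (perm_mem perm_S) mem_cat.
  have [|c_l] := boolP (c \in boxes l); [by left | right].
  pose d := (c.1, b.2).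
  have := ideal_boxes v_p (_ : d.1 <= b.1) (leqnn d.2); rewrite !mem_v b_S orbT.
  move=> /(_ le1 isT)/orP[d_l|d_S].
    by rewrite (id_l d c _ _ d_l) in c_l.
  have : c \in boxes v by apply: (@ideal_boxes v v_p d c (leqnn _) le2); rewrite mem_v d_S orbT.
  rewrite mem_v (negbTE c_l) /= => c_S; split=> //.
  apply: (@leq_trans (index d S)).
    have [/eqP eq_2|ne_2] := boolP (c.2 == d.2).
      by rewrite (_ : c = d) // [c]surjective_pairing eq_2.
    have := S_row c d c_S d_S; rewrite /entry eqxx ltn_neqAle ne_2 /= le2 ltnS.
    by move=> /= /ltnW.
  have [/eqP eq_1|ne_1] := boolP (d.1 == b.1).
    by rewrite (_ : d = b) // [b]surjective_pairing -eq_1.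
  have := S_col d b d_S b_S; rewrite /entry eqxx ltn_neqAle ne_1 /= le1 ltnS.
  by move=> /= /ltnW.
case=> gr_S perm_S.
have [S_u S_l] := perm_cat_uniq (boxes_uniq v) perm_S.
have sub : all [in boxes v] (boxes l).
  by apply/allP => b b_l; rewrite /= (perm_mem perm_S) mem_cat b_l.
have S_lt b c : b \in S -> c \in S -> b.1 <= c.1 -> b.2 <= c.2 -> b != c ->
    index b S < index c S.
  move=> b_S c_S le1 le2 ne_bc.
  have [b_l|[_ le_i]] := growth_index id_l gr_S c_S le1 le2.
    by move: b_l; rewrite (negbTE (S_l _ b_S)).
  rewrite ltn_neqAle le_i andbT; apply: contra ne_bc => /eqP eq_i.
  by rewrite -(nth_index b b_S) eq_i nth_index.
rewrite sub mem_filter mem_permutations; apply/andP; split; last first.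
  by rewrite -(perm_cat2l (boxes l)) -(permPl perm_S) sub_perm.
apply/andP; split; apply/allrelP => b c b_S c_S;
  apply/implyP => /andP[/eqP eq_x lt_y]; rewrite /entry ltnS S_lt //;
  rewrite ?eq_x // 1?ltnW //; apply: contraTneq lt_y => ->; rewrite ltnn //.
Qed.

Lemma size_slide h t : size (jdt_slide h t) = size t.
Proof. by elim: t h => //= b t IHt h; case: ifP => _ /=; rewrite IHt. Qed.

Lemma size_rect l S : size (rectification l S) = size S.
Proof.
by rewrite /rectification; elim: (boxes l) => //= b s IHs; rewrite size_slide.
Qed.

(** The common features of the row (with [r = ltn]) and of the column (with
    [r = geq]): the shape [m] of size [n] carries just one standard tableau
    whose column word is sorted for [r], and no other composition has the same
    parts. *)
Definition sorted_shape (r : rel nat) (n : nat) (m : seq nat) : Prop :=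
  [/\ r = ltn \/ r = geq, sumn m = n, is_part m, sorted r (unzip2 (boxes m)) &
     (forall w, addables frow [::] w -> sorted r w -> size w = n ->
        w = unzip2 (boxes m))
     /\ (forall b, perm_eq b m -> b = m)].

(** Slides keep the ascents of the column word, and a straight tableau with a
    sorted column word can only be the one of shape [m]. *)
Lemma rect_eq r n m l S : sorted_shape r n m -> is_part l ->
    growth (boxes l) S ->
  (rectification l S == boxes m) = (size S == n) && sorted r (unzip2 S).
Proof.
case=> r_E sum_m m_p m_srt [m_uniq _] l_p gr_S.
have [gr_R asc_R] : growth [::] (rectification l S) /\
    ascents (rectification l S) = ascents S.
  apply: ascents_rect; [exact: ideal_nil | exact: growth_boxes|].
  by apply: eq_growth gr_S => b; rewrite cats0 mem_rev.
have [_ R_E] := (growth_tab (rectification l S) (isT : is_part [::])).1 gr_R.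
have {gr_R}[ad_R _] := (growth_tab (rectification l S) (isT : is_part [::])).1 gr_R.
have [_ m_E] := (growth_tab (boxes m) (isT : is_part [::])).1 (growth_boxes m_p).
have <- : sorted r (unzip2 (rectification l S)) = sorted r (unzip2 S).
  have [ltS geqS] := sorted_ascents S; have [ltR geqR] := sorted_ascents (rectification l S).
  by case: r_E => ->; rewrite ?ltR ?geqR asc_R.
rewrite -(size_rect l S).
apply/eqP/andP => [->|[/eqP size_R srt_R]]; first by rewrite size_boxes sum_m.
by rewrite R_E (m_uniq (unzip2 (rectification l S))) -?m_E ?size_map.
Qed.

(** By [rect_eq] the sum defining [oc] runs over the standard fillings of the
    strip with a sorted column word, and there is only one. *)
Lemma oc_run r n m l w : sorted_shape r n m -> is_part l ->
    addables frow l w -> size w = n -> sorted r w ->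
  oc l m (run frow l w) = ((-1) ^+ tab_inv (boxes l ++ tab frow l w))%R.
Proof.
move=> m_s l_p ad_w sz_w srt_w; rewrite /oc.
have l_c : is_comp l by case/andP: l_p.
have v_p := run_part l_p ad_w; set v := run frow l w in v_p *.
have gr_w : growth (boxes l) (tab frow l w).
  by apply/growth_tab; rewrite ?unzip2_tab.
have perm_w := boxes_run frow_selects l_c ad_w.
rewrite -big_filter (perm_big [:: tab frow l w]) /= ?big_seq1 //.
apply: uniq_perm; rewrite // ?filter_uniq //.
  by rewrite /skew_SYT; case: ifP => // _; rewrite filter_uniq ?permutations_uniq.
move=> S; rewrite mem_filter inE; apply/andP/eqP => [[rect_S /mem_skew_SYT]|->].
  case=> // gr_S perm_S; move: rect_S; rewrite (rect_eq m_s l_p gr_S).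
  case/andP=> /eqP sz_S srt_S.
  have [ad_S ->] := (growth_tab S l_p).1 gr_S; congr (tab _ _ _).
  have perm_wS : perm_eq (unzip2 S) w.
    have := perm_S; rewrite (permPl perm_w) perm_cat2l perm_sym => /(perm_map snd).
    by rewrite -!/(unzip2 _) unzip2_tab.
  case: m_s => -[] r_E _ _ _ _; rewrite r_E in srt_w srt_S.
    apply: (sorted_eq ltn_trans _ srt_S srt_w perm_wS).
    by move=> x y /andP[/ltnW le1 /ltnW le2]; apply: anti_leq; rewrite le1.
  exact: (sorted_eq geq_trans geq_anti srt_S srt_w perm_wS).
split; last by apply/mem_skew_SYT.
by rewrite (rect_eq m_s) // unzip2_tab size_tab sz_w eqxx.
Qed.

(** * Inversions and signs *)

Lemma word_inv_cat u v :
  word_inv (u ++ v) = word_inv u + word_inv v + sumn [seq count (gtn x) v | x <- u].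
Proof. by elim: u => /= [|x u ->]; rewrite ?addn0 // count_cat; lia. Qed.

Lemma word_inv_rcons w x : word_inv (rcons w x) = word_inv w + count (ltn x) w.
Proof.
rewrite -cats1 word_inv_cat /= !addn0; congr (_ + _).
by elim: w => //= y w ->; rewrite addn0.
Qed.

Lemma word_inv_sorted w : sorted leq w -> word_inv w = 0.
Proof.
elim/last_ind: w => // w x IHw srt_w; rewrite word_inv_rcons.
have srt_w' : sorted leq w by move: srt_w; rewrite -cats1 => /cat_sorted2[].
rewrite IHw // add0n; apply/eqP; rewrite -leqn0 leqNgt -has_count.
apply/hasPn => y y_w /=; rewrite -leqNgt.
move: srt_w; rewrite (sorted_pairwise leq_trans) pairwise_rcons => /andP[/allP + _].
exact.
Qed.

(** The inversions between [u] and [v] depend only on the letters of [u]. *)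
Lemma perm_word_inv u u' v : perm_eq u u' ->
  word_inv (u ++ v) + word_inv u' = word_inv (u' ++ v) + word_inv u.
Proof.
move=> eq_u; rewrite !word_inv_cat addnAC [RHS]addnAC; congr (_ + _); first lia.
exact/perm_sumn/perm_map.
Qed.

Lemma npairsE P t :
  npairs P t = (\sum_(b <- t) \sum_(c <- t) P b c)%N.
Proof.
rewrite /npairs -sum1_count big_mkcond big_allpairs_dep /=.
by apply: eq_bigr => b _; apply: eq_bigr => c _; case: (P b c).
Qed.

Lemma perm_npairs P s t : perm_eq s t -> npairs P s = npairs P t.
Proof.
move=> eq_st; rewrite !npairsE (perm_big _ eq_st) /=.
by apply: eq_bigr => b _; rewrite (perm_big _ eq_st).
Qed.

Lemma eq_in_npairs P P' t : {in t &, P =2 P'} -> npairs P t = npairs P' t.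
Proof.
move=> eqP; rewrite !npairsE; apply: eq_big_seq => b b_t.
by apply: eq_big_seq => c c_t; rewrite eqP.
Qed.

Lemma npairs_rcons P t x :
  npairs P (rcons t x) = npairs P t + count (P x) t + count (P^~ x) t + P x x.
Proof.
have sumE (Q : pred box) s : (\sum_(c <- s) Q c)%N = count Q s.
  by rewrite -sum1_count [RHS]big_mkcond; apply: eq_bigr => c _; case: (Q c).
rewrite !npairsE -cats1 big_cat big_seq1 /= big_cat big_seq1 /= sumE.
under eq_bigr do rewrite big_cat big_seq1 /=.
by rewrite big_split /= (sumE (P^~ x)); lia.
Qed.

Lemma entry_rcons t x b : b \in t -> entry (rcons t x) b = entry t b.
Proof. by move=> b_t; rewrite /entry -cats1 index_cat b_t. Qed.

Lemma entry_last t x : x \notin t -> entry (rcons t x) x = (size t).+1.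
Proof. by move=> x_t; rewrite /entry -cats1 index_cat (negbTE x_t) /= eqxx addn0. Qed.

Lemma entry_le t b : b \in t -> entry t b <= size t.
Proof. by rewrite /entry index_mem. Qed.

(** A later entry in a column further left is an inversion of the column word. *)
Lemma tab_invcE t : uniq t -> tab_invc t = word_inv (unzip2 t).
Proof.
elim/last_ind: t => // t x IHt; rewrite rcons_uniq => /andP[x_t t_u].
rewrite /tab_invc npairs_rcons [unzip2 _]map_rcons word_inv_rcons -IHt // ltnn /= addn0.
rewrite count_map -[count (preim _ _) _]addn0 addnA; congr (_ + _ + _).
- by apply: eq_in_npairs => b c b_t c_t; rewrite !entry_rcons.
- apply: eq_in_count => b b_t /=; rewrite (entry_rcons _ b_t) entry_last //.
  by rewrite ltnS entry_le ?andbT.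
apply/eqP; rewrite -leqn0 leqNgt -has_count; apply/hasPn => b b_t /=.
by rewrite (entry_rcons _ b_t) entry_last // [_.+1 < _]ltnNge leqW ?andbF ?entry_le.
Qed.

Lemma tab_invE t : uniq t -> tab_inv t = word_inv (unzip1 t).
Proof.
elim/last_ind: t => // t x IHt; rewrite rcons_uniq => /andP[x_t t_u].
rewrite /tab_inv npairs_rcons [unzip1 _]map_rcons word_inv_rcons -IHt // ltnn /= addn0.
rewrite count_map -[count (preim _ _) _]addn0 addnA; congr (_ + _ + _).
- by apply: eq_in_npairs => b c b_t c_t; rewrite !entry_rcons.
- apply: eq_in_count => b b_t /=; rewrite (entry_rcons _ b_t) entry_last //.
  by rewrite leqW ?andbT ?entry_le.
apply/eqP; rewrite -leqn0 leqNgt -has_count; apply/hasPn => b b_t /=.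
by rewrite (entry_rcons _ b_t) entry_last // [size t < _]ltnNge entry_le ?andbF.
Qed.

Definition southwest : rel box := fun b c => (c.1 < b.1) && (b.2 < c.2).

(** When a box [x] is added to an order ideal, a box in a later column lies in
    an earlier row and conversely.  So the boxes northeast of [x] are those in
    later columns, and the boxes southwest of [x] are those in later rows. *)
Lemma npairs_growth t : growth [::] t ->
  npairs southwest t = word_inv (unzip1 t) + word_inv (unzip2 t).
Proof.
elim/last_ind: t => // t x IHt; rewrite -cats1 => /growth_cat[gr_t [x_t xt_id _]].
rewrite cats0 mem_rev in x_t; rewrite cats0 in xt_id.
rewrite cats1 npairs_rcons [unzip2 _]map_rcons [unzip1 _]map_rcons !word_inv_rcons.
have nle b : b \in t -> ~ (x.1 <= b.1 /\ x.2 <= b.2).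
  move=> b_t [le1 le2]; move/negP: x_t; apply.
  have := @growth_index [::] t ideal_nil gr_t b x b_t le1 le2.
  by case=> // -[].
rewrite IHt // !count_map /southwest ltnn /= addn0.
have -> : count (fun c : box => (c.1 < x.1) && (x.2 < c.2)) t = count (preim snd (ltn x.2)) t.
  by apply: eq_in_count => b /nle; rewrite /=; lia.
have -> : count (fun b : box => (x.1 < b.1) && (b.2 < x.2)) t = count (preim fst (ltn x.1)) t.
  by apply: eq_in_count => b /nle; rewrite /=; lia.
by rewrite -addnA [count _ _ + count _ _]addnC addnACA.
Qed.

(** In row reading order the row indices form a sorted word. *)
Lemma rows_boxes l : unzip1 (boxes l) = power_word (iota 0 (size l)) l.
Proof.
rewrite /boxes /power_word /unzip1 map_flatten -map_comp; congr flatten.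
apply: (@eq_from_nth _ [::]) => [|i]; rewrite !size_map ?size_zip size_iota ?minnn // => lt_i.
rewrite (nth_map 0) ?size_iota // (nth_map (0, 0)) ?size_zip ?size_iota ?minnn //.
rewrite nth_zip ?size_iota //= nth_iota // add0n -map_comp.
have const_i q m : [seq i | _ <- iota m q] = nseq q i.
  by elim: q m => //= q IHq m; rewrite IHq.
exact: const_i.
Qed.

Lemma NE_cols l : is_part l -> NE l = word_inv (unzip2 (boxes l)).
Proof.
move=> l_p; rewrite /NE -/southwest (npairs_growth (growth_boxes l_p)) rows_boxes.
by rewrite word_inv_sorted // power_word_sorted // iota_ltn_sorted.
Qed.

Lemma NE_run l w : is_part l -> addables frow l w ->
  NE (run frow l w) = tab_inv (boxes l ++ tab frow l w)
                      + word_inv (unzip2 (boxes l) ++ w).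
Proof.
move=> l_p ad_w; have l_c : is_comp l by case/andP: l_p.
have perm_w := boxes_run frow_selects l_c ad_w.
have gr_w : growth (boxes l) (tab frow l w).
  by apply/growth_tab; rewrite ?unzip2_tab.
rewrite /NE -/southwest (perm_npairs _ perm_w) npairs_growth; last first.
  apply/growth_cat; split; first exact: growth_boxes.
  by apply: eq_growth gr_w => b; rewrite cats0 mem_rev.
rewrite tab_invE; last by rewrite -(perm_uniq perm_w) boxes_uniq.
by rewrite /unzip2 [in X in _ + X]map_cat -!/(unzip2 _) unzip2_tab.
Qed.

(** By [npairs_growth], [NE] of the large partition counts the inversions of
    the row word, which give the sign in [oc], and those of the column word
    of [(T_l)_S].  The latter differ from the inversions of [w1 ++ w2] in the
    same way as [NE] of the small partition from the inversions of [w1],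
    since [w1] and the columns of [T_l] have the same letters. *)
Lemma sign_run w1 w2 : addables lrow [::] (w1 ++ w2) ->
    let a := run lrow [::] w1 in let l := sort_comp a in
  odd (NE (sort_comp (run lrow a w2)) + word_inv (w1 ++ w2))
    = odd (tab_inv (boxes l ++ tab frow l w2) + (NE l + word_inv w1)).
Proof.
rewrite addables_cat => /andP[ad_1 ad_2] a l.
have a_c : is_comp a by apply: run_comp ad_1 => //; apply: lrow_selects.
have [ad_2l sort_2] := sort_run a_c ad_2.
have l_p : is_part l by apply: sort_comp_part.
have [ad_1l] := sort_run (isT : is_comp [::]) ad_1; rewrite -/l => sort_1.
have perm_1 : perm_eq (unzip2 (boxes l)) w1.
  have := perm_map snd (boxes_run frow_selects (isT : is_comp [::]) ad_1l).
  by rewrite -sort_1 -!/(unzip2 _) unzip2_tab.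
rewrite sort_2 NE_run // NE_cols //.
have /(congr1 odd) := perm_word_inv w2 perm_1; rewrite !oddD -!addbA.
case: (odd (tab_inv _)) => //=; case: (odd (word_inv (_ ++ w2))); 
  case: (odd (word_inv (w1 ++ w2))); case: (odd (word_inv w1)); by case: (odd _).
Qed.

(** * Composition tableaux and chains as column words *)

Lemma SYCTP a t : t \in SYCT a <->
  [/\ perm_eq t (boxes a),
   forall i j j', (i, j) \in t -> (i, j') \in t -> j < j' ->
     entry t (i, j) < entry t (i, j'),
   forall i i', (i, 0) \in t -> (i', 0) \in t -> i < i' ->
     entry t (i, 0) < entry t (i', 0) &
   forall i k j, (i, k) \in t -> (j, k.+1) \in t -> j < i ->
     entry t (i, k) <= entry t (j, k.+1) ->
     (i, k.+1) \in t /\ entry t (i, k.+1) < entry t (j, k.+1)].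
Proof.
rewrite /SYCT mem_filter mem_permutations; split.
  case/andP=> /and3P[/allrelP t_row /allrelP t_col /allrelP t_tri] ->; split=> //.
  - by move=> i j j' t_j t_j' lt_j; have /= := t_row _ _ t_j t_j'; rewrite eqxx lt_j.
  - by move=> i j t_i t_j lt_i; have /= := t_col _ _ t_i t_j; rewrite lt_i.
  move=> i k j t_i t_j lt_ji le_e; have /= := t_tri _ _ t_i t_j.
  by rewrite lt_ji eqxx le_e /= => /andP[].
case=> -> t_row t_col t_tri; rewrite andbT; apply/and3P; split; apply/allrelP.
- move=> [i j] [i' j'] t_i t_j; apply/implyP => /= /andP[/eqP eq_i lt_j].
  by subst i'; apply: t_row.
- move=> [i j] [i' j'] t_i t_j; apply/implyP => /= /and3P[/eqP ? /eqP ? lt_i].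
  by subst j j'; apply: t_col.
move=> [i k] [j k'] t_i t_j; apply/implyP => /= /and3P[lt_ji /eqP ? le_e].
by subst k'; apply/andP/t_tri.
Qed.

(** A box at the end of the last row of its length satisfies the triple rule:
    the rows below that reach its left neighbour are longer. *)
Lemma SYCT_rcons a c t : is_comp a -> addable a c -> t \in SYCT a ->
  rcons t (lrow a c, c) \in SYCT (add_box lrow a c).
Proof.
move=> a_c ad_c /SYCTP[t_a t_row t_col t_tri]; set x := (lrow a c, c).
have [nth_c _] := lrow_selects a_c ad_c.
have mem_t b : (b \in t) = (b.2 < nth 0 a b.1) by rewrite (perm_mem t_a) mem_boxes.
have x_t : x \notin t by rewrite mem_t /= nth_c ltnn.
have lt_x b : b \in t -> entry (rcons t x) b < entry (rcons t x) x.
  by move=> b_t; rewrite entry_rcons // entry_last // ltnS entry_le.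
have lt_xF b : b \in t -> entry (rcons t x) x <= entry (rcons t x) b -> False.
  by move=> b_t; rewrite leqNgt lt_x.
apply/SYCTP; split.
- rewrite perm_rcons perm_sym (permPl (boxes_add_box lrow_selects a_c ad_c)).
  by rewrite perm_cons perm_sym.
- move=> i j j'; rewrite !mem_rcons !inE.
  have [eq_x|_] /= := eqVneq (i, j) x; have [eq_x'|_] /= := eqVneq (i, j') x.
  + by case: eq_x eq_x' => _ -> [_ ->]; rewrite ltnn.
  + case: eq_x => -> ->; rewrite mem_t /= nth_c; lia.
  + by rewrite eq_x' => t_j _ _; apply: lt_x.
  by move=> t_j t_j'; rewrite !entry_rcons //; apply: t_row.
- move=> i i'; rewrite !mem_rcons !inE.
  have [eq_x|_] /= := eqVneq (i, 0) x; have [eq_x'|_] /= := eqVneq (i', 0) x.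
  + by case: eq_x eq_x' => -> _ [-> _]; rewrite ltnn.
  + case: eq_x nth_c => -> <- nth_c; rewrite mem_t /= => _ lt_i.
    rewrite (selects_row0 lrow_selects a_c) => le_i.
    by move: lt_i; rewrite nth_default // ltnW.
  + by rewrite eq_x' => t_j _ _; apply: lt_x.
  by move=> t_j t_j'; rewrite !entry_rcons //; apply: t_col.
move=> i k j; rewrite !mem_rcons !inE.
have [eq_x|_] /= := eqVneq (i, k) x; have [eq_x'|_] /= := eqVneq (j, k.+1) x.
- by case: eq_x eq_x' => -> _ [->]; rewrite ltnn.
- by rewrite eq_x => _ t_j _ /lt_xF [].
- rewrite eq_x' => t_i _ lt_ji _; case: eq_x' => eq_j eq_k.
  suff t_k : (i, k.+1) \in t by rewrite t_k orbT lt_x.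
  rewrite mem_t /= ltn_neqAle; move: t_i; rewrite mem_t /= => ->; rewrite andbT.
  by rewrite eq_sym eq_k lrow_last // -?eq_k // eq_k -eq_j.
move=> t_i t_j lt_ji; rewrite (entry_rcons x t_i) (entry_rcons x t_j) => le_e.
have [t_k lt_e] := t_tri _ _ _ t_i t_j lt_ji le_e.
by rewrite t_k orbT entry_rcons.
Qed.

(** The largest entry ends its row.  If it is in the first column it is the
    last row; otherwise the triple rule forbids a lower row that would have
    the same length once the box is removed. *)
Lemma SYCT_last b t x : is_comp b -> rcons t x \in SYCT b ->
  exists a, [/\ is_comp a, addable a x.2, x = (lrow a x.2, x.2),
                b = add_box lrow a x.2 & t \in SYCT a].
Proof.
case: x => k c b_c /SYCTP[tx_b t_row t_col t_tri] /=; set x := (k, c) in tx_b t_row t_col t_tri *.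
have mem_tx y : (y \in rcons t x) = (y.2 < nth 0 b y.1).
  by rewrite (perm_mem tx_b) mem_boxes.
have : uniq (rcons t x) by rewrite (perm_uniq tx_b) boxes_uniq.
rewrite rcons_uniq => /andP[x_t t_u].
have x_tx : x \in rcons t x by rewrite mem_rcons inE eqxx.
have lt_k : c < nth 0 b k by have := mem_tx x; rewrite x_tx => <-.
have lt_xF y : y \in rcons t x -> entry (rcons t x) x < entry (rcons t x) y -> False.
  rewrite mem_rcons inE => /orP[/eqP -> |y_t]; first by rewrite ltnn.
  by rewrite entry_last // entry_rcons // ltnNge leqW ?entry_le.
have nth_k : nth 0 b k = c.+1.
  apply/eqP; rewrite eqn_leq lt_k andbT leqNgt; apply/negP => lt_k'.
  have y_tx : (k, c.+1) \in rcons t x by rewrite mem_tx.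
  exact: lt_xF y_tx (t_row _ _ _ x_tx y_tx (ltnSn c)).
have lt_ks : k < size b by rewrite ltnNge; apply/negP => /(nth_default 0); rewrite nth_k.
have [a [a_c ad_c row_c nth_a]] : exists a, [/\ is_comp a, addable a c, lrow a c = k
    & forall i, nth 0 b i = nth 0 a i + (i == k)].
  case: (posnP c) => [c0|c_gt0].
    have size_b : size b = k.+1.
      apply/eqP; rewrite eqn_leq lt_ks andbT leqNgt; apply/negP => lt_k1.
      have y_tx : (k.+1, 0) \in rcons t x by rewrite mem_tx comp_nth.
      have eq_x : x = (k, 0) by rewrite /x c0.
      have := t_col k k.+1; rewrite -eq_x => /(_ x_tx y_tx (ltnSn k)).
      exact: lt_xF.
    have a_c : is_comp (take k b) by apply/allP => y /mem_take/(allP b_c).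
    exists (take k b); split=> //; first by rewrite c0.
      by rewrite c0 selects_row0 ?size_take ?lt_ks //; apply: lrow_selects.
    move=> i; have [lt_i|lt_i|->] := ltngtP i k.
    - by rewrite nth_take // addn0.
    - by rewrite !nth_default ?size_take ?lt_ks ?size_b // ltnW.
    by rewrite [nth 0 (take _ _) _]nth_default ?size_take ?lt_ks // nth_k c0.
  have nth_a i : nth 0 (set_nth 0 b k c) i = if i == k then c else nth 0 b i.
    by rewrite nth_set_nth.
  have size_a : size (set_nth 0 b k c) = size b.
    by rewrite size_set_nth; apply/maxn_idPr.
  have a_c : is_comp (set_nth 0 b k c).
    apply/(all_nthP 0) => i; rewrite size_a nth_a => lt_i.
    by case: eqP => // _; apply: comp_nth.
  have ad_c : addable (set_nth 0 b k c) c.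
    by rewrite /addable orbC; have := nth_a k; rewrite eqxx => {1}<-; rewrite mem_nth ?size_a.
  exists (set_nth 0 b k c); split=> //; last first.
    by move=> i; rewrite nth_a; case: eqP => [->|]; rewrite ?addn0 // addn1.
  have [nth_c _] := lrow_selects a_c ad_c.
  have [lt_l|lt_l|//] := ltngtP (lrow (set_nth 0 b k c) c) k.
    by have := lrow_last a_c c_gt0 lt_l; rewrite nth_a !eqxx.
  move: nth_c; rewrite nth_a (gtn_eqF lt_l) => nth_l.
  set i := lrow _ _ in lt_l nth_l *; have eq_c := prednK c_gt0.
  have t_i : (i, c.-1) \in rcons t x by rewrite mem_tx /= nth_l eq_c.
  have := t_tri i c.-1 k t_i; rewrite eq_c => /(_ x_tx lt_l)[].
    by rewrite leqNgt; apply/negP => /(lt_xF _ t_i).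
  by rewrite mem_tx /= nth_l ltnn.
have b_E : b = add_box lrow a c.
  apply: boxes_inj => //; first by apply: add_box_comp => //; apply: lrow_selects.
  move=> y; rewrite !mem_boxes nth_add_box ?row_c ?nth_a //; exact: lrow_selects.
have t_a : perm_eq t (boxes a).
  rewrite -(perm_cons x) -perm_rcons (permPl tx_b) b_E.
  by rewrite (permPl (boxes_add_box lrow_selects a_c ad_c)) row_c.
have t_tx y : y \in t -> y \in rcons t x by rewrite mem_rcons inE orbC => ->.
exists a; split=> //; first by rewrite row_c.
apply/SYCTP; split=> //.
- move=> i j j' t_j t_j' lt_j; have := t_row _ _ _ (t_tx _ t_j) (t_tx _ t_j') lt_j.
  by rewrite !entry_rcons.
- move=> i i' t_i t_i' lt_i; have := t_col _ _ (t_tx _ t_i) (t_tx _ t_i') lt_i.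
  by rewrite !entry_rcons.
move=> i m j t_i t_j lt_ji le_e.
have := t_tri _ _ _ (t_tx _ t_i) (t_tx _ t_j) lt_ji.
rewrite (entry_rcons x t_i) (entry_rcons x t_j) => /(_ le_e)[].
rewrite mem_rcons inE => /orP[/eqP ->|t_m]; last by rewrite entry_rcons.
by rewrite entry_last // ltnNge ltnW // ltnS entry_le.
Qed.

(** Standard Young composition tableaux are saturated chains from the empty
    composition, each recorded by its column sequence. *)
Lemma mem_SYCT b t : is_comp b -> t \in SYCT b <->
  [/\ addables lrow [::] (unzip2 t), run lrow [::] (unzip2 t) = b
    & t = tab lrow [::] (unzip2 t)].
Proof.
elim/last_ind: t b => [|t x IHt] b b_c.
  split=> [/SYCTP[/perm_size size_b _ _ _]|[_ <- _]]; last by [].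
  split=> //; rewrite size_boxes in size_b.
  by case: b b_c size_b => [|[]].
have -> : unzip2 (rcons t x) = rcons (unzip2 t) x.2 by exact: map_rcons.
rewrite -[rcons (unzip2 t) _]cats1 addables_cat run_cat tab_cat /= andbT cats1.
split=> [/(SYCT_last b_c)[a [a_c ad_x x_E b_E /(IHt _ a_c)[ad_t run_t t_E]]]|].
  by rewrite ad_t run_t ad_x -t_E -x_E -b_E.
case=> /andP[ad_t ad_x] b_E /rcons_inj[t_E x_E].
set a := run _ _ _ in ad_x b_E x_E.
have a_c : is_comp a by apply: run_comp ad_t => //; apply: lrow_selects.
by rewrite x_E -b_E; apply: SYCT_rcons => //; apply/IHt.
Qed.

Definition words (b : seq nat) : seq (seq nat) := [seq unzip2 t | t <- SYCT b].

Lemma mem_words b w : is_comp b ->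
  (w \in words b) = addables lrow [::] w && (run lrow [::] w == b).
Proof.
move=> b_c; apply/mapP/andP => [[t /(mem_SYCT _ b_c)[ad_t run_t _] ->]|[ad_w /eqP run_w]].
  by rewrite ad_t run_t.
by exists (tab lrow [::] w); [apply/(mem_SYCT _ b_c) |]; rewrite unzip2_tab.
Qed.

Lemma words_uniq b : is_comp b -> uniq (words b).
Proof.
move=> b_c; rewrite map_inj_in_uniq; first by rewrite filter_uniq ?permutations_uniq.
by move=> s t /(mem_SYCT _ b_c)[_ _ {2}->] /(mem_SYCT _ b_c)[_ _ {2}->] ->.
Qed.

Lemma size_words b w : is_comp b -> w \in words b -> size w = sumn b.
Proof.
move=> b_c; rewrite mem_words // => /andP[ad_w /eqP <-].
by rewrite (sumn_run lrow_selects (isT : is_comp [::]) ad_w).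
Qed.

Lemma added_columnE a c : is_comp a -> addable a c ->
  added_column a (add_box lrow a c) = c.
Proof.
move=> a_c ad_c; rewrite /added_column.
have memE x : (x \in [seq x <- boxes (add_box lrow a c) | x \notin boxes a])
    = (x == (lrow a c, c)).
  rewrite mem_filter (perm_mem (boxes_add_box lrow_selects a_c ad_c)) inE.
  case: (eqVneq x (lrow a c, c)) => [->|_]; last by rewrite andNb.
  by rewrite mem_boxes /= (lrow_selects a_c ad_c).1 ltnn.
case: [seq _ <- _ | _] memE => [/(_ (lrow a c, c))|x s /(_ x)]; first by rewrite eqxx.
by rewrite inE eqxx => /esym/eqP ->.
Qed.

(** The two kinds of covers are the addition of a box in the first column and
    in a later one. *)
Lemma coversP a b : is_comp a ->
  reflect (exists2 c, addable a c & b = add_box lrow a c) (covers a b).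
Proof.
move=> a_c.
have row1 : add_box lrow a 0 = rcons a 1.
  rewrite /add_box (selects_row0 lrow_selects a_c).
  by elim: (a) => //= x s ->.
apply: (iffP orP) => [[/eqP ->|/hasP[k]]|[c ad_c ->]].
- by exists 0.
- rewrite mem_iota add0n => /= lt_k /andP[nth_k /eqP ->].
  have ad_c : addable a (nth 0 a k) by rewrite /addable mem_nth ?orbT.
  exists (nth 0 a k); rewrite // /add_box; congr (set_nth _ _ _ _).
  have [nth_l _] := lrow_selects a_c ad_c.
  have lt_l := selects_size lrow_selects a_c ad_c (comp_nth a_c lt_k).
  case: (ltngtP k (lrow a (nth 0 a k))) => // [lt_kl|lt_lk].
    case/negP: nth_k; rewrite -nth_l -[lrow _ _](subnKC lt_kl) -nth_drop.
    by rewrite mem_nth // size_drop ltn_sub2r // (leq_ltn_trans lt_kl).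
  by have := lrow_last a_c (comp_nth a_c lt_k) lt_lk; rewrite eqxx.
case: (posnP c) => [->|c_gt0]; first by rewrite row1; left.
right; have [nth_c _] := lrow_selects a_c ad_c.
apply/hasP; exists (lrow a c).
  by rewrite mem_iota add0n selects_size //; apply: lrow_selects.
rewrite nth_c eqxx andbT; apply/(nthP 0) => -[i _]; rewrite nth_drop => nth_i.
by have := @lrow_last a c ((lrow a c).+1 + i) a_c c_gt0; rewrite nth_i eqxx leq_addr => /(_ isT).
Qed.

(** The column sequence of a chain determines the chain. *)
Lemma saturated_chainP r a n b : is_comp a ->
  saturated_chain r a n b <->
  exists w, [/\ size w = n, addables lrow a w, run lrow a w = b & sorted r w].
Proof.
move=> a_c; split=> [[s [size_s path_s last_s srt_s]]|[w [size_w ad_w run_w srt_w]]].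
  exists (pairmap added_column a s); rewrite size_pairmap; split=> //;
    move: path_s last_s {size_s srt_s}.
    elim: s a a_c => //= b' s IHs a a_c /andP[/(coversP _ a_c)[c ad_c ->] path_s last_s].
    by rewrite added_columnE // ad_c IHs // add_box_comp //; apply: lrow_selects.
  elim: s a a_c => //= b' s IHs a a_c /andP[/(coversP _ a_c)[c ad_c ->] path_s last_s].
  by rewrite added_columnE // IHs // add_box_comp //; apply: lrow_selects.
exists (scanl (add_box lrow) a w); rewrite size_scanl.
have [path_w col_w] : path covers a (scanl (add_box lrow) a w) /\
    pairmap added_column a (scanl (add_box lrow) a w) = w.
  elim: w a a_c ad_w {size_w run_w srt_w} => //= c w IHw a a_c /andP[ad_c ad_w].
  have [|-> ->] := IHw (add_box lrow a c) _ ad_w.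
    by apply: add_box_comp => //; apply: lrow_selects.
  by rewrite added_columnE //; split=> //; rewrite andbT; apply/coversP => //; exists c.
split=> //; last by rewrite col_w.
by rewrite -run_w; elim: (w) a {a_c ad_w run_w path_w col_w} => //= c v IHv a.
Qed.

(** * Descents *)

Definition blocks (c w : seq nat) : bool :=
  (sumn c == size w) && all (sorted ltn) (reshape c w).

Lemma scanl_addn x y c : scanl addn (x + y) c = [seq x + z | z <- scanl addn y c].
Proof. by elim: c y => //= p c IHc y; rewrite -addnA IHc. Qed.

Lemma psums_cons p c : partial_sums (p :: c) = p :: [seq p + z | z <- partial_sums c].
Proof. by rewrite /partial_sums /= add0n -scanl_addn addn0. Qed.

Lemma mem_psums_sumn c : 0 < sumn c -> sumn c \in partial_sums c.
Proof.
elim: c => // p c IHc _; rewrite psums_cons inE /=.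
by have [->|/IHc c_in] := posnP (sumn c); rewrite ?addn0 ?eqxx // map_f ?orbT.
Qed.

(** Truncated subtraction inverts addition along a nondecreasing sequence. *)
Lemma pairmap_subK x s : path leq x s ->
  scanl addn x (pairmap (fun y z => z - y) x s) = s
  /\ x + sumn (pairmap (fun y z => z - y) x s) = last x s.
Proof.
elim: s x => [|y s IHs] x /=; first by rewrite addn0.
by case/andP=> le_xy /IHs[]; rewrite addnA subnKC // => -> ->.
Qed.

Lemma refines_psums N D c : refines c (comp_of_psums N D) =
  (sumn c == N) && all [in partial_sums c] [seq m <- iota 1 N | (m == N) || D m].
Proof.
rewrite /refines /comp_of_psums; set s := [seq _ <- _ | _].
have srt_s : path leq 0 s.
  rewrite path_min_sorted; last by apply/allP.
  apply: sorted_filter; [exact: leq_trans | exact: iota_sorted].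
have [psE] := pairmap_subK srt_s; rewrite /partial_sums psE add0n => ->.
suff -> : last 0 s = N by [].
rewrite /s; case: (N) => // n.
have -> : iota 1 n.+1 = iota 1 n ++ [:: n.+1] by rewrite -(addn1 n) iotaD add1n addn1.
by rewrite filter_cat /= eqxx last_cat.
Qed.

(** The partial sums of [c] are the places where one block ends and the next
    begins. *)
Lemma blocksP c w : is_comp c -> sumn c = size w ->
  reflect (forall m, 0 < m < size w -> m \notin partial_sums c ->
             nth 0 w m.-1 < nth 0 w m)
          (all (sorted ltn) (reshape c w)).
Proof.
elim: c w => [|p c IHc] w; first by case: w => // _ _; constructor=> m; rewrite ltn0 andbF.
case/andP=> p_gt0 c_c /= size_w.
have size_v : sumn c = size (drop p w) by rewrite size_drop -size_w addKn.
have size_u : size (take p w) = p.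
  by rewrite size_take -size_w; case: ltngtP (leq_addr (sumn c) p).
rewrite psums_cons; apply: (iffP andP) => [[/(sortedP 0) u_srt /(IHc _ c_c size_v) v_srt]|G].
  move=> m /andP[m_gt0 lt_m]; rewrite inE negb_or => /andP[ne_mp m_c].
  have [lt_mp|lt_pm|eq_mp] := ltngtP m p; last by rewrite eq_mp eqxx in ne_mp.
    have := u_srt m.-1; rewrite prednK // size_u => /(_ lt_mp).
    by rewrite !nth_take // prednK // ltnW.
  have := v_srt (m - p); rewrite !nth_drop subnKC ?(ltnW lt_pm) //.
  have -> : p + (m - p).-1 = m.-1 by lia.
  apply; first by rewrite size_drop; lia.
  by apply: contra m_c => m_c; apply/mapP; exists (m - p); rewrite ?subnKC // ltnW.
split.
  apply/(sortedP 0) => i; rewrite size_u => lt_i; rewrite !nth_take //; last exact: ltnW.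
  apply: (G i.+1); first by rewrite /= -size_w (leq_trans lt_i) ?leq_addr.
  rewrite inE negb_or (ltn_eqF lt_i) /=; apply/mapP => -[z _]; lia.
apply/(IHc _ c_c size_v) => m; rewrite size_drop => /andP[m_gt0 lt_m] m_c.
rewrite !nth_drop; have -> : p + m.-1 = (p + m).-1 by lia.
apply: G; first by rewrite addn_gt0 p_gt0 /=; lia.
rewrite inE negb_or -{2}[p]addn0 eqn_add2l -lt0n m_gt0 /=.
by apply/mapP => -[z z_c /addnI eq_z]; rewrite eq_z z_c in m_c.
Qed.

(** [c] refines the descent composition when every descent is a partial sum of
    [c], that is, when no descent falls inside a block. *)
Lemma refines_descent c t : is_comp c ->
  refines c (descent_comp t) = blocks c (unzip2 t).
Proof.
move=> c_c; rewrite /descent_comp refines_psums /blocks size_map.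
case: eqP => //= size_t.
have size_w : sumn c = size (unzip2 t) by rewrite size_map.
have colE m : (box_of t m.+1).2 = nth 0 (unzip2 t) m.
  rewrite /box_of /=; have [lt_m|ge_m] := ltnP m (size t).
    by rewrite (nth_map (0, 0)).
  by rewrite !nth_default ?size_map.
apply/allP/(blocksP c_c size_w) => [H m|H m].
  rewrite size_map => /andP[m_gt0 lt_m]; apply: contraNltn => le_m; apply: H.
  rewrite mem_filter mem_iota m_gt0 add1n ltnS (ltnW lt_m) andbT /= orbC colE.
  by rewrite -[in box_of t m](prednK m_gt0) colE le_m.
rewrite mem_filter mem_iota add1n ltnS => /andP[D_m /andP[m_gt0 le_m]].
have [eq_m|ne_m] := eqVneq m (size t).
  by rewrite /= eq_m -size_t mem_psums_sumn // size_t -eq_m.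
have {le_m} lt_m : m < size t by rewrite ltn_neqAle ne_m.
move: D_m; rewrite (negbTE ne_m) /= colE -[in box_of t m](prednK m_gt0) colE leqNgt.
by apply: contraNT => m_c; apply: H; rewrite ?size_map ?m_gt0.
Qed.

Lemma reshape_take (T : Type) c (w : seq T) : reshape c (take (sumn c) w) = reshape c w.
Proof.
elim: c w => //= p c IHc w.
by rewrite -take_min (minn_idPl (leq_addr _ _)) addnC -take_drop IHc.
Qed.

Lemma reshape_cat (T : Type) c d (w : seq T) :
  reshape (c ++ d) w = reshape c w ++ reshape d (drop (sumn c) w).
Proof. by elim: c w => [|p c IHc] w /=; rewrite ?drop0 // IHc drop_drop [p + _]addnC. Qed.

(** Each factor determines its share of the size, so the cut at [sumn c] is the
    right one. *)
Lemma blocks_cat c d w : blocks (c ++ d) w =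
  blocks c (take (sumn c) w) && blocks d (drop (sumn c) w).
Proof.
rewrite /blocks reshape_cat all_cat reshape_take sumn_cat size_take size_drop.
rewrite andbACA; congr (_ && _).
case: ltngtP; lia.
Qed.

Lemma blocks1 n w : blocks [:: n] w = (size w == n) && sorted ltn w.
Proof.
rewrite /blocks /= addn0 andbT eq_sym.
by case: eqP => //= <-; rewrite take_size.
Qed.

Lemma blocks_cons1 c x w : blocks (1 :: c) (x :: w) = blocks c w.
Proof. by rewrite /blocks /= take0 drop0. Qed.

Lemma blocks_consS p c x y w :
  blocks (p.+2 :: c) (x :: y :: w) = (x < y) && blocks (p.+1 :: c) (y :: w).
Proof. by rewrite /blocks /= !addSn !eqSS; case: (x < y) => //=; rewrite andbF. Qed.

(** * The pairing and its values on products *)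

Local Open Scope ring_scope.
Import GRing.Theory.

Lemma is_comp_word_comp (w : {fmonom nat}) : is_comp (word_comp w).
Proof. by rewrite /word_comp /is_comp all_map; apply/allP. Qed.

Lemma H_word_comp (k : comNzRingType) (w : {fmonom nat}) :
  H_ k (word_comp w) = << w >>.
Proof.
rewrite H_E; congr << _ >>; apply/val_inj => /=.
by rewrite /word_comp -map_comp map_id_in.
Qed.

(** The letter [i] of the free monoid stands for the part [i.+1]. *)
Definition monom_comp (c : seq nat) : {fmonom nat} := FMonom [seq p.-1 | p <- c].

Lemma monom_compK c : is_comp c -> word_comp (monom_comp c) = c.
Proof.
move=> /allP c_c; rewrite /word_comp /= -map_comp map_id_in // => p /c_c /=.
exact: prednK.
Qed.

Lemma word_compK : cancel word_comp monom_comp.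
Proof. by move=> w; apply/val_inj => /=; rewrite -map_comp map_id_in. Qed.

Lemma is_comp_cat c d : is_comp (c ++ d) = is_comp c && is_comp d.
Proof. exact: all_cat. Qed.

Lemma H_cat (k : comNzRingType) c d : H_ k (c ++ d) = H_ k c * H_ k d.
Proof. by rewrite /H_ big_cat. Qed.

Lemma scale_monom (k : comNzRingType) (x : k) (w : {fmonom nat}) :
  x *: << w >> = << x *g w >> :> NSym k.
Proof. by apply/malgP => v; rewrite mcoeffZ !mcoeffU mulr_natr. Qed.

(** Scalars are central because [k] is commutative. *)
Lemma H_mulZ (k : comNzRingType) c d (x : k) :
  H_ k c * (x *: H_ k d) = x *: H_ k (c ++ d).
Proof.
rewrite H_cat !H_E scale_monom [LHS]malgM_def.
have -> : << monom_comp c >> * << monom_comp d >>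
    = fgmul << monom_comp c >> << monom_comp d >> :> NSym k by exact: malgM_def.
by rewrite !fgmulUU mul1r mulr1 scale_monom.
Qed.

(** A map that preserves combinations [c *: g + h] is linear, hence determined
    by its values on the basis of the [H_ c]. *)
Lemma eq_linear_H (k : comNzRingType) (phi psi : NSym k -> k) :
    (forall c g h, phi (c *: g + h) = c * phi g + phi h) ->
    (forall c g h, psi (c *: g + h) = c * psi g + psi h) ->
    (forall c, is_comp c -> phi (H_ k c) = psi (H_ k c)) ->
  phi =1 psi.
Proof.
move=> phi_lin psi_lin eq_H g.
have lin0 f : (forall c g h, f (c *: g + h) = c * f g + f h) -> f 0 = 0 :> k.
  by move=> f_lin; have := f_lin (-1) 0 0; rewrite scaler0 addr0 mulN1r addNr.
rewrite [g]monalgE; elim: (msupp g : seq _) => [|w s IHs].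
  by rewrite big_nil !lin0.
rewrite big_cons; have -> : << g@_w *g w >> = g@_w *: H_ k (word_comp w) :> NSym k.
  by rewrite H_word_comp scale_monom.
by rewrite phi_lin psi_lin IHs eq_H ?is_comp_word_comp.
Qed.

Lemma pairing0 (k : comNzRingType) f : pairing f (0 : NSym k) = 0.
Proof.
by have := pairing_linear f (-1) 0 0; rewrite scaler0 addr0 mulN1r addNr.
Qed.

Lemma pairing_sum (k : comNzRingType) f (I : Type) (s : seq I) (P : pred I)
    (c : I -> k) (g : I -> NSym k) :
  pairing f (\sum_(i <- s | P i) c i *: g i) = \sum_(i <- s | P i) c i * pairing f (g i).
Proof.
elim: s => [|i s IHs]; first by rewrite !big_nil pairing0.
by rewrite !big_cons; case: (P i); rewrite // pairing_linear IHs.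
Qed.

Lemma pairing_H (k : comNzRingType) (f : ncseries k) c : is_comp c ->
  pairing f (H_ k c) = Acoef f (power_word (iota 0 (size c)) c).
Proof.
move=> c_c; rewrite H_E /pairing msuppU oner_eq0 big_seq_fset1 mcoeffUU mulr1.
by rewrite -/(monom_comp c) monom_compK //= size_map.
Qed.

Lemma Acoef_sum (k : comNzRingType) (I : Type) (s : seq I) (P : pred I)
    (c : I -> k) (f : I -> ncseries k) w :
  Acoef (fun u => \sum_(i <- s | P i) c i * f i u) w
    = \sum_(i <- s | P i) c i * Acoef (f i) w.
Proof.
rewrite /Acoef; under eq_bigr do rewrite mulr_sumr.
rewrite exchange_big; apply: eq_bigr => i _ /=; rewrite mulr_sumr.
by apply: eq_bigr => u _; rewrite mulrCA.
Qed.

(** Dual bases: the coefficient of [M_c] in [F_a] is 1 or 0 according as [c]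
    refines [a]. *)
Lemma pairing_F (k : comNzRingType) a c : is_comp c ->
  pairing (F_ k a) (H_ k c) = (refines c a)%:R.
Proof.
move=> c_c; rewrite pairing_H //.
have -> : Acoef (F_ k a) =1
    Acoef (fun u => \sum_(b <- comps (sumn a) | refines b a) 1 * M_ k b u).
  move=> w; apply: eq_bigr => u _; congr (_ * _).
  by apply: eq_bigr => b _; rewrite mul1r.
rewrite Acoef_sum.
rewrite big_seq_cond (eq_bigr (fun b => (b == c)%:R)); last first.
  move=> b /andP[]; rewrite mem_comps => /andP[b_c _] _.
  by rewrite -pairing_H // pairingMH // mul1r.
have [ref_c|ref_c] := boolP (refines c a); last first.
  by rewrite big1 // => b /andP[_ ref_b]; case: eqP ref_c => // <-; rewrite ref_b.
have c_in : c \in comps (sumn a) by rewrite mem_comps c_c; case/andP: ref_c.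
rewrite big_mkcond (bigD1_seq c) ?comps_uniq //= c_in ref_c eqxx big1 ?addr0 //.
by move=> b /negbTE ->; case: ifP.
Qed.

Lemma pairing_S (k : comNzRingType) b c : is_comp b -> is_comp c ->
  pairing (S_ k b) (H_ k c) = (-1) ^+ NE (sort_comp b) *
    \sum_(w <- words b) (-1) ^+ word_inv w * (blocks c w)%:R.
Proof.
move=> b_c c_c; rewrite pairing_H //.
pose f t := (-1) ^+ NE (sort_comp b) * (-1) ^+ tab_invc t : k.
have -> : Acoef (S_ k b) =1
    Acoef (fun u => \sum_(t <- SYCT b) f t * F_ k (descent_comp t) u).
  move=> w; apply: eq_bigr => u _; congr (_ * _).
  by rewrite /S_ mulr_sumr; apply: eq_bigr => t _; rewrite mulrA.
rewrite Acoef_sum /words big_map mulr_sumr; apply: eq_big_seq => t t_b.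
rewrite -pairing_H // pairing_F // refines_descent // mulrA /f tab_invcE //.
by move: t_b; rewrite mem_filter mem_permutations => /andP[_ /perm_uniq ->]; apply: boxes_uniq.
Qed.

(** Pairing with a product by [X] on the right cuts off the last [n] letters
    of a column word, and keeps the words for which these are sorted. *)
Definition cuts_sorted (k : comNzRingType) (r : rel nat) (n : nat) (X : NSym k) : Prop :=
  forall b c, is_comp b -> is_comp c ->
    pairing (S_ k b) (H_ k c * X) = (-1) ^+ NE (sort_comp b) *
      \sum_(w <- words b) (-1) ^+ word_inv w *
         [&& size w == (sumn c + n)%N, blocks c (take (sumn c) w)
           & sorted r (drop (sumn c) w)]%:R.

Lemma cuts_sorted_H (k : comNzRingType) n : (0 < n)%N -> cuts_sorted ltn n (H_ k [:: n]).
Proof.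
move=> n_gt0 b c b_c c_c; rewrite -H_cat pairing_S //; last first.
  by rewrite is_comp_cat c_c /= n_gt0.
congr (_ * _); apply: eq_bigr => w _; congr (_ * _%:R); congr nat_of_bool.
rewrite blocks_cat blocks1.
case: (boolP (blocks c _)) => [/andP[/eqP + _]|_]; last by rewrite andbF.
rewrite size_take size_drop /= => size_c; congr (_ && _).
by move: size_c; case: ltngtP; lia.
Qed.

(** The noncommutative elementary function of degree [n], as an alternating
    sum of the [H_c]. *)
Definition E_ (k : comNzRingType) (n : nat) : NSym k :=
  \sum_(c <- comps n) (-1) ^+ (n - size c) *: H_ k c.

Lemma comp_size c : is_comp c -> (size c <= sumn c)%N.
Proof. by elim: c => //= p c IHc /andP[p_gt0 /IHc]; lia. Qed.

(** Inclusion and exclusion.  The compositions of the word length are paired: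
    the first letter is a block of its own, or it is merged with the next
    block.  The two terms cancel unless the first letter starts a descent. *)
Lemma sum_blocks (k : comNzRingType) w :
  \sum_(c <- comps (size w)) (-1) ^+ (size w - size c) * (blocks c w)%:R
    = (sorted geq w)%:R :> k.
Proof.
elim: w => [|x w IHw]; first by rewrite /= big_seq1 subnn mul1r.
rewrite /= big_cat !big_map /= big_filter.
under eq_bigr do rewrite subSS blocks_cons1.
rewrite IHw.
case: w IHw => [|y w] IHw; first by rewrite /= big_cons big_nil /= addr0.
rewrite big_mkcond big_seq.
rewrite (eq_bigr (fun c => - (x < y)%N%:R *
  ((-1) ^+ (size (y :: w) - size c) * (blocks c (y :: w))%:R))); last first.
  move=> c; rewrite mem_comps => /andP[c_c /eqP sum_c].
  have := comp_size c_c; rewrite sum_c; case: c c_c sum_c => [|[|p] c] //= _ _ le_c.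
  rewrite blocks_consS subSn // exprS -mulnb natrM mulN1r !mulNr; congr (- _).
  by rewrite mulrCA.
rewrite -big_seq -mulr_sumr IHw /= mulNr.
by case: (ltnP x y); case: (path _ _ _); rewrite ?mulr1 ?mulr0 ?mul1r ?mul0r ?subrr ?subr0.
Qed.

Lemma cuts_sorted_E (k : comNzRingType) n : cuts_sorted geq n (E_ k n).
Proof.
move=> b c b_c c_c; rewrite /E_ [H_ k c * _]mulr_sumr.
under eq_bigr do rewrite H_mulZ.
rewrite pairing_sum big_seq.
under eq_bigr => d d_n.
  rewrite pairing_S //; last first.
    by move: d_n; rewrite mem_comps is_comp_cat c_c => /andP[].
  rewrite mulrCA mulr_sumr.
  over.
rewrite -big_seq -mulr_sumr; congr (_ * _); rewrite exchange_big; apply: eq_bigr => w _ /=.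
under eq_bigr do rewrite mulrCA blocks_cat -mulnb natrM (mulrCA _ (blocks c _)%:R).
rewrite -!mulr_sumr; congr (_ * _); rewrite andbCA -mulnb natrM.
have [c_w|_] := boolP (blocks c (take (sumn c) w)); last by rewrite !mul0r.
have le_c : (sumn c <= size w)%N.
  by move: c_w => /andP[/eqP + _]; rewrite size_take; case: ltngtP; lia.
rewrite !mul1r.
have [size_w|ne_w] := eqVneq (size w) (sumn c + n)%N.
  by rewrite /= -sum_blocks size_drop size_w addKn.
rewrite big_seq big1 // => d; rewrite mem_comps => /andP[_ /eqP sum_d].
rewrite /blocks size_drop sum_d; case: eqP => [eq_n|_]; last by rewrite mulr0.
by rewrite eq_n subnKC ?eqxx in ne_w.
Qed.

(** * The Pieri rules *)

Lemma sorted_shape_row n : (0 < n)%N -> sorted_shape ltn n [:: n].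
Proof.
move=> n_gt0; have cols : unzip2 (boxes [:: n]) = iota 0 n.
  by rewrite /boxes /= cats0 /unzip2 -map_comp map_id.
split; [by left | exact: addn0 | by rewrite /is_part /= n_gt0 | |].
  by rewrite cols iota_ltn_sorted.
split=> [w ad_w srt_w size_w|b eq_b]; last exact: perm_small_eq.
have row p v : (0 < p)%N -> addables frow [:: p] v -> path ltn p.-1 v ->
    v = iota p (size v).
  elim: v p => //= c v IHv p p_gt0 /andP[ad_c ad_v] /andP[lt_c path_v].
  have eq_c : c = p by move: ad_c; rewrite /addable inE; lia.
  subst c; move: ad_v; rewrite /add_box /frow /= eqxx => ad_v.
  by rewrite (IHv p.+1) ?size_iota.
rewrite cols; case: w ad_w srt_w size_w => [_ _ <-|c v] //= /andP[/orP[/eqP ->|//] ad_v] path_v <-.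
by rewrite {1}(row 1%N v).
Qed.

Lemma sorted_shape_col n : (0 < n)%N -> sorted_shape geq n (nseq n 1%N).
Proof.
move=> n_gt0; have sum_n : sumn (nseq n 1%N) = n by rewrite sumn_nseq mul1n.
have cols : unzip2 (boxes (nseq n 1%N)) = nseq n 0%N.
  have /all_pred1P : all (pred1 0%N) (unzip2 (boxes (nseq n 1%N))).
    apply/allP => _ /mapP[b + ->]; rewrite mem_boxes nth_nseq /=.
    by case: ifP => // _; case: b.2.
  by rewrite size_map size_boxes sum_n.
have srt (x : nat) m : sorted geq (nseq m x).
  by case: m => //= m; elim: m => //= m ->; rewrite leqnn.
split; [by right | exact: sum_n | | by rewrite cols |].
  by rewrite /is_part srt andbT /is_comp all_nseq orbT.
split=> [w ad_w srt_w size_w|b eq_b].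
  rewrite cols -size_w; apply/all_pred1P.
  case: w ad_w srt_w {size_w} => //= c v /andP[/orP[/eqP ->|//] _].
  by move=> /(order_path_min geq_trans); apply: sub_all => x; rewrite /= leqn0.
have -> : n = size b by rewrite (perm_size eq_b) size_nseq.
by apply/all_pred1P; rewrite (perm_all _ eq_b) all_nseq /= orbT.
Qed.

Lemma sorted_shape_order r n m : sorted_shape r n m -> transitive r /\ antisymmetric r.
Proof.
case=> -[] -> _ _ _ _; split.
- exact: ltn_trans.
- by move=> x y /andP[/ltnW le1 /ltnW le2]; apply: anti_leq; rewrite le1.
- exact: geq_trans.
- exact: geq_anti.
Qed.

Lemma oc_sign (k : comNzRingType) r n m u v : sorted_shape r n m ->
    addables lrow [::] (u ++ v) -> size v = n -> sorted r v ->
  let a := run lrow [::] u in let b := run lrow a v in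
  (-1) ^+ NE (sort_comp b) * (-1) ^+ word_inv (u ++ v)
    = (oc (sort_comp a) m (sort_comp b))%:~R
      * ((-1) ^+ NE (sort_comp a) * (-1) ^+ word_inv u) :> k.
Proof.
move=> m_s ad_uv size_v srt_v a b; have /= := sign_run ad_uv; rewrite -/a -/b => sign_uv.
move: ad_uv; rewrite addables_cat => /andP[ad_u ad_v].
have a_c : is_comp a by apply: run_comp ad_u => //; apply: lrow_selects.
have [ad_v' sort_b] := sort_run a_c ad_v.
rewrite [in oc _ _ _]sort_b (oc_run m_s) ?sort_comp_part //.
rewrite rmorphXn rmorphN1 -!exprD -[LHS]signr_odd sign_uv signr_odd.
by [].
Qed.

(** Cutting a word of shape [b] after [sumn b - n] letters gives a word of
    some shape [a] and a sorted word from [a] to [b], unique if there is one;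
    [oc_sign] compares the signs. *)
Lemma pieri_H (k : comNzRingType) r n m (X : NSym k) b c :
    sorted_shape r n m -> cuts_sorted r n X -> is_comp b -> is_comp c ->
  pairing (S_ k b) (H_ k c * X) =
    \sum_(a <- comps (sumn b - n) | `[< saturated_chain r a n b >])
       (oc (sort_comp a) m (sort_comp b))%:~R * pairing (S_ k a) (H_ k c).
Proof.
move=> m_s X_cuts b_c c_c; rewrite X_cuts //.
have [r_tr r_anti] := sorted_shape_order m_s; set p := (sumn b - n)%N.
have comps_c a : a \in comps p -> is_comp a by rewrite mem_comps => /andP[].
have chain_sum a : is_comp a -> saturated_chain r a n b -> (sumn a + n)%N = sumn b.
  move=> a_c /(saturated_chainP _ _ _ a_c)[v [<- ad_v <- _]].
  by rewrite (sumn_run lrow_selects a_c ad_v).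
(* If [b] has fewer than [n] boxes, both sides vanish. *)
have [lt_b|le_n] := ltnP (sumn b) n.
  rewrite big_seq big1 ?mulr0 => [|w w_b]; last first.
    by rewrite (size_words b_c w_b); case: eqP => [|_]; [lia | rewrite mulr0].
  rewrite big_seq_cond big1 // => a /andP[/comps_c a_c /asboolP/(chain_sum _ a_c)]; lia.
pose T w : k := (-1) ^+ word_inv w * (blocks c (take p w) && sorted r (drop p w))%:R.
pose A w := run lrow [::] (take p w).
have wordsE w : w \in words b -> [/\ size w = (p + n)%N, A w \in comps p,
    take p w \in words (A w), addables lrow (A w) (drop p w) & run lrow (A w) (drop p w) = b].
  move=> w_b; have size_w := size_words b_c w_b.
  move: w_b; rewrite mem_words // -{1 2}(cat_take_drop p w) addables_cat run_cat -/(A w).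
  case/andP=> /andP[ad_u ad_v] /eqP run_v.
  have A_c : is_comp (A w) by apply: run_comp ad_u => //; apply: lrow_selects.
  split=> //; first by rewrite size_w subnK.
    rewrite mem_comps A_c /A (sumn_run lrow_selects (isT : is_comp [::]) ad_u).
    by rewrite size_takel ?size_w ?leq_subr /= ?add0n.
  by rewrite mem_words // ad_u eqxx.
rewrite (eq_big_seq T) => [|w w_b]; last first.
  have [size_w _ _ _ _] := wordsE w w_b; rewrite /T; congr (_ * _%:R); congr nat_of_bool.
  rewrite size_w eqn_add2r; have [->//|ne_c] := eqVneq p (sumn c).
  by rewrite /= /blocks size_takel ?size_w ?leq_addr // eq_sym (negbTE ne_c).
have chainE w : w \in words b -> sorted r (drop p w) -> saturated_chain r (A w) n b.
  move=> w_b srt_w; have [size_w A_p _ ad_v run_v] := wordsE w w_b.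
  apply/(saturated_chainP _ _ _ (comps_c _ A_p)); exists (drop p w).
  by rewrite size_drop size_w addKn.
(* Group the words by the shape of their first [p] letters. *)
rewrite (eq_big_seq (fun w =>
    \sum_(a <- comps p | `[< saturated_chain r a n b >]) (a == A w)%:R * T w)); last first.
  move=> w w_b; have [size_w A_p _ ad_v run_v] := wordsE w w_b.
  have [srt_w|not_srt] := boolP (sorted r (drop p w)); last first.
    rewrite big1 => [|a _]; rewrite /T (negbTE not_srt) andbF ?mulr0 //.
  rewrite big_mkcond (bigD1_seq (A w)) ?comps_uniq //= eqxx mul1r big1 ?addr0.
    by case: asboolP => // -[]; apply: chainE.
  by move=> a /negbTE ->; rewrite mul0r; case: ifP.
rewrite exchange_big /= mulr_sumr big_seq_cond [RHS]big_seq_cond.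
apply: eq_bigr => a /andP[a_p /asboolP a_chain]; have a_c := comps_c a a_p.
have [v [size_v ad_v run_v srt_v]] := (saturated_chainP r n b a_c).1 a_chain.
have words_a w : w \in words a -> size w = p.
  by move/(size_words a_c) => ->; move: a_p; rewrite mem_comps => /andP[_ /eqP].
(* For a fixed shape [a] the sorted tail is always [v]. *)
have words_cat : perm_eq [seq w <- words b | (a == A w) && sorted r (drop p w)]
    [seq u ++ v | u <- words a].
  apply: uniq_perm; rewrite ?filter_uniq ?words_uniq //.
    rewrite map_inj_in_uniq ?words_uniq // => u u' /words_a size_u /words_a size_u' eq_uv.
    by rewrite -(take_size_cat v size_u) eq_uv take_size_cat.
  move=> w; rewrite mem_filter; apply/andP/mapP => [[/andP[/eqP a_E srt_w] w_b]|[u u_a ->]].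
    have [_ _ u_A ad_w run_w] := wordsE w w_b; rewrite -a_E in u_A ad_w run_w.
    exists (take p w); rewrite // -{1}(cat_take_drop p w); congr (_ ++ _).
    apply: (run_sorted_inj lrow_selects a_c r_tr r_anti srt_w srt_v ad_w ad_v).
    by rewrite run_w run_v.
  have size_u := words_a u u_a.
  move: u_a; rewrite !mem_words // /A drop_size_cat // take_size_cat //.
  case/andP=> ad_u /eqP run_u.
  by rewrite srt_v andbT eq_sym addables_cat run_cat ad_u run_u run_v ad_v !eqxx.
rewrite (eq_bigr (fun w => if (a == A w) && sorted r (drop p w) then T w else 0)); last first.
  move=> w _; rewrite /T; case: (a == A w); rewrite ?mul0r // mul1r.
  by case: (sorted r _); rewrite // andbF mulr0.
rewrite -big_mkcond -big_filter (perm_big _ words_cat) big_map /= pairing_S //.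
rewrite !mulr_sumr; apply: eq_big_seq => u u_a.
have size_u := words_a u u_a.
move: u_a; rewrite mem_words // => /andP[ad_u /eqP run_u].
have ad_uv : addables lrow [::] (u ++ v) by rewrite addables_cat ad_u run_u.
rewrite /T take_size_cat // drop_size_cat // srt_v andbT.
have := oc_sign k m_s ad_uv size_v srt_v; rewrite /= run_u run_v => sign_uv.
by rewrite !mulrA sign_uv !mulrA.
Qed.

Lemma pieri_pairing (k : comNzRingType) r n m (X : NSym k) b g :
    sorted_shape r n m -> cuts_sorted r n X -> is_comp b ->
  pairing (S_ k b) (g * X) =
    \sum_(a <- comps (sumn b - n) | `[< saturated_chain r a n b >])
       (oc (sort_comp a) m (sort_comp b))%:~R * pairing (S_ k a) g.
Proof.
move=> m_s X_cuts b_c; move: g.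
apply: eq_linear_H => [x g h|x g h|c c_c]; last exact: pieri_H.
  by rewrite mulrDl -scalerAl pairing_linear.
rewrite mulr_sumr -big_split; apply: eq_bigr => a _ /=.
by rewrite pairing_linear mulrDr mulrCA.
Qed.

(** The case of an empty first factor: only the shape [m] has a sorted word
    of full length, and there the two signs are equal.  So [X] is the dual
    basis element of [m]. *)
Lemma pairing_shape (k : comNzRingType) r n m (X : NSym k) b :
    sorted_shape r n m -> cuts_sorted r n X -> is_comp b ->
  pairing (S_ k b) X = (b == m)%:R.
Proof.
move=> m_s X_cuts b_c; rewrite -[X]mul1r.
have -> : 1 = H_ k [::] by rewrite /H_ big_nil.
rewrite X_cuts //; set wm := unzip2 (boxes m).
have [r_E sum_m m_p srt_m [m_uniq m_rigid]] := m_s.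
have m_c : is_comp m by case/andP: m_p.
have nil_p : is_part [::] by [].
have [ad_m m_E] := (growth_tab (boxes m) nil_p).1 (growth_boxes m_p).
have run_m : run frow [::] wm = m.
  apply: boxes_inj => //; first exact: run_comp frow_selects _ ad_m.
  by apply/perm_mem; rewrite (permPl (boxes_run frow_selects _ ad_m)) // -m_E.
have [ad_wm eq_wm] := perm_run frow_selects lrow_selects (isT : is_comp [::]) (perm_refl _) ad_m.
have run_wm : run lrow [::] wm = m by apply: m_rigid; rewrite perm_sym -{1}run_m.
rewrite (eq_big_seq (fun w => if w == wm then (-1) ^+ word_inv wm else 0)); last first.
  move=> w; rewrite mem_words // => /andP[ad_w _]; rewrite drop0 take0 add0n /=.
  have [->|ne_w] := eqVneq w wm.
    by rewrite /wm srt_m size_map size_boxes sum_m eqxx mulr1.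
  have [ad_w' _] := perm_run lrow_selects frow_selects (isT : is_comp [::]) (perm_refl _) ad_w.
  case: eqP => size_w; last by rewrite mulr0.
  have [srt_w|_] := boolP (sorted r w); last by rewrite mulr0.
  by rewrite (m_uniq w) ?eqxx in ne_w.
rewrite -big_mkcond.
have [eq_b|ne_b] := eqVneq b m.
  rewrite eq_b big_mkcond (bigD1_seq wm) ?words_uniq //= ?eqxx ?mem_words ?ad_wm ?run_wm ?eqxx //.
  rewrite big1 => [|w /negbTE ->] //.
  by rewrite addr0 part_sort // NE_cols // -expr2 sqrr_sign.
rewrite big_seq_cond big1 ?mulr0 // => w /andP[w_b /eqP w_E].
by move: w_b ne_b; rewrite mem_words // w_E run_wm => /andP[_ /eqP ->]; rewrite eqxx.
Qed.

Lemma pairing_H0 (k : comNzRingType) b c : is_comp b -> is_comp c ->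
  sumn c != sumn b -> pairing (S_ k b) (H_ k c) = 0.
Proof.
move=> b_c c_c ne_bc; rewrite pairing_S // big_seq big1 ?mulr0 // => w.
by move/(size_words b_c) => size_w; rewrite /blocks size_w (negbTE ne_bc) mulr0.
Qed.

Lemma pairing_coord (k : comNzRingType) b (g : NSym k) : is_comp b ->
  pairing (S_ k b) g =
    \sum_(c <- comps (sumn b)) pairing (S_ k b) (H_ k c) * g@_(monom_comp c).
Proof.
move=> b_c; move: g; apply: eq_linear_H => [x g h|x g h|c c_c].
- exact: pairing_linear.
- rewrite mulr_sumr -big_split; apply: eq_bigr => c _ /=.
  by rewrite mcoeffD mcoeffZ mulrDr mulrCA.
have coefH d : is_comp d -> (H_ k c)@_(monom_comp d) = (d == c)%:R.
  move=> d_c; rewrite H_E -/(monom_comp c) mcoeffU1; congr (nat_of_bool _)%:R.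
  by apply/eqP/eqP => [eq_m|->//]; rewrite -(monom_compK d_c) -eq_m monom_compK.
have [c_in|c_out] := boolP (c \in comps (sumn b)).
  rewrite (bigD1_seq c) ?comps_uniq //= coefH // eqxx mulr1 big_seq_cond big1 ?addr0 //.
  by move=> d /andP[]; rewrite mem_comps => /andP[d_c _] /negbTE ne_d; rewrite coefH // ne_d mulr0.
rewrite big_seq big1; first by rewrite pairing_H0 //; move: c_out; rewrite mem_comps c_c.
move=> d d_in; have d_c : is_comp d by move: d_in; rewrite mem_comps => /andP[].
by rewrite coefH //; case: eqP d_in c_out => [->->//|]; rewrite mulr0.
Qed.

(** A square matrix over a commutative ring that has a right inverse has a
    left inverse.  So a dual basis can exist only if, in each degree, the
    pairings with the [S_b] determine all coordinates of an element. *)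
Lemma pairing_inj (k : comNzRingType) (Sdual : seq nat -> NSym k) (g h : NSym k) :
    S_dual_basis Sdual ->
    (forall b, is_comp b -> pairing (S_ k b) g = pairing (S_ k b) h) ->
  g = h.
Proof.
move=> hS eq_gh; pose d := -1 *: h + g.
have d0 b : is_comp b -> pairing (S_ k b) d = 0.
  by move=> b_c; rewrite pairing_linear eq_gh // mulN1r addNr.
suff d_E : d = 0 by apply/eqP; rewrite -subr_eq0 addrC -scaleN1r -/d d_E.
apply/malgP => w; rewrite mcoeff0 -[w]word_compK.
have w_c := is_comp_word_comp w; set c := word_comp w in w_c *.
set s := comps (sumn c); pose e i := nth [::] s i.
have e_s (i : 'I_(size s)) : e i \in s by rewrite mem_nth.
have e_c (i : 'I_(size s)) : is_comp (e i) && (sumn (e i) == sumn c).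
  by have := e_s i; rewrite mem_comps.
pose K := \matrix_(i < size s, j < size s) pairing (S_ k (e i)) (H_ k (e j)).
pose D := \matrix_(j < size s, i < size s) (Sdual (e i))@_(monom_comp (e j)).
have sumE (i : 'I_(size s)) f : pairing (S_ k (e i)) f
    = \sum_(j < size s) K i j * f@_(monom_comp (e j)).
  have /andP[ei_c /eqP sum_i] := e_c i.
  rewrite pairing_coord // sum_i -/s (big_nth [::]) big_mkord.
  by apply: eq_bigr => j _; rewrite mxE.
(* [D] is the matrix of coordinates of the given dual basis in one degree. *)
have KD : K *m D = 1%:M.
  apply/matrixP => i j; rewrite !mxE.
  have /andP[ei_c _] := e_c i; have /andP[ej_c _] := e_c j.
  rewrite -[RHS](_ : pairing (S_ k (e i)) (Sdual (e j)) = _).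
    by rewrite sumE; apply: eq_bigr => l _; rewrite [D _ _]mxE.
  by rewrite hS // nth_uniq // comps_uniq.
have Kv : K *m (\col_(j < size s) d@_(monom_comp (e j))) = 0.
  apply/colP => i; rewrite !mxE -[RHS](d0 (e i)); last by case/andP: (e_c i).
  by rewrite sumE; apply: eq_bigr => l _; rewrite !mxE.
have /matrixP v0 : \col_(j < size s) d@_(monom_comp (e j)) = 0.
  by rewrite -[LHS]mul1mx -(mulmx1C KD) -mulmxA Kv mulmx0.
have c_s : c \in s by rewrite mem_comps w_c eqxx.
have lt_c : (index c s < size s)%N by rewrite index_mem.
by have := v0 (Ordinal lt_c) ord0; rewrite !mxE /e nth_index.
Qed.

(** Both sides have the same pairing with every [S_b]. *)
Lemma pieri (k : comNzRingType) (Sdual : seq nat -> NSym k) r n m (X : NSym k) a :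
    S_dual_basis Sdual -> sorted_shape r n m -> cuts_sorted r n X -> is_comp a ->
  Sdual a * Sdual m =
    \sum_(b <- comps (sumn a + n) | `[< saturated_chain r a n b >])
       (oc (sort_comp a) m (sort_comp b))%:~R *: Sdual b.
Proof.
move=> hS m_s X_cuts a_c.
have m_c : is_comp m by case: m_s => _ _ /andP[].
have -> : Sdual m = X.
  by apply: (pairing_inj hS) => b b_c; rewrite hS // (pairing_shape m_s X_cuts).
apply: (pairing_inj hS) => b b_c.
rewrite (pieri_pairing _ m_s X_cuts b_c) pairing_sum.
have chain_sum a' b' : is_comp a' -> saturated_chain r a' n b' -> (sumn a' + n)%N = sumn b'.
  move=> a_c' /(saturated_chainP _ _ _ a_c')[v [<- ad_v <- _]].
  by rewrite (sumn_run lrow_selects a_c' ad_v).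
have pick (s : seq (seq nat)) (P : pred (seq nat)) x (f : seq nat -> k) : uniq s ->
    \sum_(y <- s | P y) f y * (y == x)%:R = if (x \in s) && P x then f x else 0.
  move=> s_u; have [x_s|x_s] := boolP (x \in s); last first.
    by rewrite big_seq_cond big1 // => y /andP[y_s _]; case: eqP x_s => [<-|]; rewrite ?y_s ?mulr0.
  rewrite big_mkcond (bigD1_seq x) //= eqxx mulr1 big1 ?addr0 // => y /negbTE ->.
  by rewrite mulr0 if_same.
transitivity (\sum_(a' <- comps (sumn b - n) | `[< saturated_chain r a' n b >])
    (oc (sort_comp a') m (sort_comp b))%:~R * (a' == a)%:R : k).
  rewrite big_seq_cond [RHS]big_seq_cond; apply: eq_bigr => a' /andP[+ _].
  by rewrite mem_comps => /andP[a_c' _]; rewrite hS.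
rewrite pick ?comps_uniq //.
transitivity (\sum_(b' <- comps (sumn a + n) | `[< saturated_chain r a n b' >])
    (oc (sort_comp a) m (sort_comp b'))%:~R * (b' == b)%:R : k); last first.
  rewrite big_seq_cond [RHS]big_seq_cond; apply: eq_bigr => b' /andP[+ _].
  by rewrite mem_comps => /andP[b_c' _]; rewrite hS // eq_sym.
rewrite pick ?comps_uniq // !mem_comps a_c b_c /=.
case: asboolP => [/(chain_sum _ _ a_c) <-|_]; last by rewrite !andbF.
by rewrite addnK !eqxx.
Qed.

Theorem corollary6p15 (k : comNzRingType) (Sdual : seq nat -> NSym k)
    (hS : S_dual_basis Sdual) (a : seq nat) (ha : is_comp a)
    (n : nat) (hn : (1 <= n)%N) :
  Sdual a * Sdual [:: n]
    = \sum_(b <- comps (sumn a + n) | `[< saturated_chain ltn a n b >])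
        (oc (sort_comp a) [:: n] (sort_comp b))%:~R *: Sdual b
  /\
  Sdual a * Sdual (nseq n 1%N)
    = \sum_(b <- comps (sumn a + n) | `[< saturated_chain geq a n b >])
        (oc (sort_comp a) (nseq n 1%N) (sort_comp b))%:~R *: Sdual b.
Proof.
split; first exact: pieri hS (sorted_shape_row hn) (cuts_sorted_H k hn) ha.
exact: pieri hS (sorted_shape_col hn) (cuts_sorted_E k n) ha.
Qed.
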